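(* Let $X=E_7/P_7$ and let $\lambda_1,\dots,\lambda_7$ be the fundamental dominant weights of $E_7$. For every integer $r\ge0$ there is the irreducible decomposition $$\mathrm{Sym}^rT_X=\bigoplus_{\substack{i+2j+3k=r\\ i,j,k\ge0}}E_{i\lambda_1+j\lambda_6+k\cdot2\lambda_7},$$ and the fundamental highest weights of $T_X^*$ are $\lambda_1,\lambda_6,2\lambda_7$, of degrees $1,2,3$ respectively.
   Context: Everything is over $\mathbb{C}$. Simple roots $\alpha_i$ and fundamental weights $\lambda_i$ of $G=E_7$ are in Bourbaki order; $P_7$ is the maximal parabolic subgroup attached to $\alpha_7$, with the convention that its Lie algebra $\mathfrak p_7$ contains all negative root spaces, so that the weights of $\mathfrak g/\mathfrak p_7$ are the positive roots involving $\alpha_7$. Homogeneous vector bundles on $G/P_7$ are identified with $P_7$-modules, $T_X$ corresponding to $\mathfrak g/\mathfrak p_7$. $E_\lambda$ denotes the irreducible homogeneous vector bundle (irreducible $P_7$-module) with highest weight $\lambda$ with respect to the Levi part $R$ of $P_7$. Fundamental highest weights: for an $R$-module $V$ such that every irreducible $R$-module occurs at most once in the algebra of polynomials $\mathcal P(V)=\bigoplus_{i\ge0}\mathrm{Sym}^i(V^* )$, let $\Lambda$ be the set of highest weights occurring in $\mathcal P(V)$ and $h_\lambda$ the (unique up to scalar, homogeneous) highest weight vector of weight $\lambda\in\Lambda$. The fundamental highest weights of $V$ are the $\lambda\in\Lambda$ with $h_\lambda$ an irreducible polynomial; the degree of a fundamental highest weight $\omega$ is $\deg h_\omega$. Those of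 $T_X^*$ are the ones for $V=(\mathfrak g/\mathfrak p_7)^*$, so $\mathcal P(V)=\bigoplus_r\mathrm{Sym}^r(\mathfrak g/\mathfrak p_7)$. *)

(* Defs.v *)
From HB Require Import structures.
From mathcomp Require Import all_boot all_order all_algebra.
From mathcomp Require Import mpoly.

Set Implicit Arguments.
Unset Strict Implicit.
Unset Printing Implicit Defensive.

Import Order.TTheory GRing.Theory Num.Theory.

Local Open Scope ring_scope.

(* An element of the root lattice is the sequence of its 7 coordinates in the
   basis of simple roots.  Indices are shifted by one with respect to
   Bourbaki: alpha_(i+1) is [simple_root i], for i = 0, ..., 6. *)

(* The Bourbaki diagram: the chain 1-3-4-5-6-7, with 2 attached to 4. *)
Definition e7_edges : seq (nat * nat) :=
  [:: (0, 2); (1, 3); (2, 3); (3, 4); (4, 5); (5, 6)]%N.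

Definition e7_cartan (i j : nat) : int :=
  if i == j then 2
  else if ((i, j) \in e7_edges) || ((j, i) \in e7_edges) then -1 else 0.

(* <a, alpha_i^vee>, i.e. the coordinate of a on the fundamental weight i.
   Folds over [iota 0 7] rather than \sum so that [roots] below computes. *)
Definition pairing (a : seq int) (i : nat) : int :=
  foldr (fun j s => a`_j * e7_cartan j i + s) 0 (iota 0 7).

Definition simple_root (i : nat) : seq int := mkseq (fun j => (i == j)%:R) 7.

Definition reflect_root (i : nat) (a : seq int) : seq int :=
  mkseq (fun j => a`_j - (i == j)%:R * pairing a i) 7.

(* From the positive roots of height n to those of height n + 1: reflect_root i
   adds alpha_i to a when <a, alpha_i^vee> = -1. *)
Definition next_level (s : seq (seq int)) : seq (seq int) :=
  undup (flatten
    [seq [seq reflect_root i a | i <- iota 0 7 & pairing a i == -1] | a <- s]).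

Definition positive_roots : seq (seq int) :=
  flatten (traject next_level (mkseq simple_root 7) 17).

(* Locked to keep unification from computing the list; rewrite with [rootsE]
   before [vm_compute]. *)
Fact roots_key : unit. Proof. exact: tt. Qed.
Definition roots : seq (seq int) :=
  locked_with roots_key
    (positive_roots ++ [seq map -%R a | a <- positive_roots]).

Lemma rootsE :
  roots = positive_roots ++ [seq map -%R a | a <- positive_roots].
Proof. exact: unlock. Qed.

Lemma size_roots : size roots = 126%N.
Proof. by rewrite rootsE; vm_compute. Qed.

Lemma uniq_roots : uniq roots.
Proof. by rewrite rootsE; vm_compute. Qed.

Definition stable_under_reflections (s : seq (seq int)) : bool :=
  all (fun a => all (fun i => reflect_root i a \in s) (iota 0 7)) s.

Lemma roots_stable : stable_under_reflections roots.
Proof. by rewrite rootsE; vm_compute. Qed.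

(* The 27 positive roots involving alpha_7. *)
Definition tangent_roots : seq (seq int) := [seq a <- roots | 0 < a`_6].

Lemma size_tangent_roots : size tangent_roots = 27%N.
Proof. by rewrite /tangent_roots rootsE; vm_compute. Qed.

Lemma tangent_root_subproof (b : 'I_27) : nth [::] tangent_roots b \in roots.
Proof.
have: nth [::] tangent_roots b \in tangent_roots.
  by rewrite mem_nth // size_tangent_roots.
by rewrite mem_filter => /andP[].
Qed.

Definition root := seq_sub roots.

Definition coef (a : root) (j : nat) : int := (val a)`_j.

Definition positive_root (a : root) : bool := all (fun x => 0 <= x) (val a).

Definition lattice_add (a b : seq int) : seq int :=
  mkseq (fun j => a`_j + b`_j) 7.

(* A bilinear form B on the root lattice with B(a, a) = (a, a) / 2 and
   B(a, b) + B(b, a) = (a, b) mod 2. *)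
Definition eps_form (a b : root) : int :=
  \sum_(i < 7) coef a i * coef b i + \sum_(e <- e7_edges) coef a e.1 * coef b e.2.

Definition tangent_root (b : 'I_27) : root := SeqSub (tangent_root_subproof b).

(* A weight is given by its coordinates on the fundamental weights. *)

Definition weight := 'rV[int]_7.

Definition lambda1 : weight := delta_mx 0 (inord 0).
Definition lambda6 : weight := delta_mx 0 (inord 5).
Definition lambda7 : weight := delta_mx 0 (inord 6).

Section E7.

Variable F : fieldType.

(* The pair (h, x) is \sum_i h_i alpha_i^vee + \sum_a x_a E_a. *)
Definition e7 : Type := ('rV[F]_7 * {ffun root -> F^o})%type.

HB.instance Definition _ := GRing.Lmodule.on e7.

Definition eps (a b : root) : F := (-1) ^ eps_form a b.

Definition root_eval (h : 'rV[F]_7) (a : root) : F :=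
  \sum_(i < 7) h 0 i * (pairing (val a) i)%:~R.

(* The Frenkel-Kac construction: [h, E_a] = a(h) E_a,
   [E_a, E_b] = eps(a, b) E_(a + b) if a + b is a root,
   [E_a, E_(-a)] = eps(a, -a) a^vee, where the coordinates of a^vee on the
   simple coroots are those of a on the simple roots (E7 is simply laced), and
   [E_a, E_b] = 0 otherwise. *)
Definition bracket (x y : e7) : e7 :=
  (\row_(j < 7) \sum_(a : root)
     \sum_(b : root | lattice_add (val a) (val b) == nseq 7 0)
       eps a b * x.2 a * y.2 b * (coef a j)%:~R,
   [ffun c : root =>
      root_eval x.1 c * y.2 c - root_eval y.1 c * x.2 c +
      \sum_(a : root) \sum_(b : root | lattice_add (val a) (val b) == val c)
        eps a b * x.2 a * y.2 b]).

Definition root_vector (a : root) : e7 := (0, [ffun c => (c == a)%:R]).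

(* The maximal parabolic subalgebra containing all negative root spaces. *)
Definition p7 (x : e7) : Prop := forall a : root, 0 < coef a 6 -> x.2 a = 0.

(* exp (c ad E_a); the series stops because (ad E_a)^3 = 0 in a simply laced
   Lie algebra. *)
Definition exp_ad (a : root) (c : F) (y : e7) : e7 :=
  \sum_(k < 3) (c ^+ k / k`!%:R) *: iter k (bracket (root_vector a)) y.

Definition character (lam : weight) (t : 'I_7 -> F) : F :=
  \prod_(i < 7) t i ^ lam 0 i.

Definition root_weight (a : root) : weight := \row_(i < 7) pairing (val a) i.

(* The element \prod_i alpha_i^vee(t_i) of the maximal torus. *)
Definition torus (t : 'I_7 -> F) (y : e7) : e7 :=
  (y.1, [ffun a => character (root_weight a) t * y.2 a]).

(* The subgroup of E7 generated by the maximal torus and the root subgroups U_a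
   with a in S, acting in the adjoint representation.  Inverses need no
   constructor, since the inverse of a generator is a generator. *)
Inductive root_subgroup (S : pred root) : (e7 -> e7) -> Prop :=
| root_subgroup_id : root_subgroup S id
| root_subgroup_torus t s : (forall i, t i != 0) ->
    root_subgroup S s -> root_subgroup S (torus t \o s)
| root_subgroup_exp a c s : S a ->
    root_subgroup S s -> root_subgroup S (exp_ad a c \o s).

Definition P7 := root_subgroup (fun a => coef a 6 <= 0).
Definition levi_P7 := root_subgroup (fun a => coef a 6 == 0).

Lemma P7_stable_p7 s : P7 s -> forall x, p7 x -> p7 (s x).
Proof.
elim=> {s} [//|t s _ _ IH|a c s Sa _ IH] x /IH {IH} px.
  by move=> b b0 /=; rewrite ffunE px // mulr0.
have pbr y : p7 y -> p7 (bracket (root_vector a) y).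
  move=> py d d0; rewrite /= !ffunE py // mulr0 add0r.
  case: eqP => [eda|_]; first by move: d0; rewrite eda ltNge Sa.
  rewrite mulr0 oppr0 add0r.
  apply: big1 => b _; apply: big1 => e /eqP eab; rewrite !ffunE.
  case: eqP => [eba|]; last by rewrite mulr0 mul0r.
  rewrite py ?mulr0 // -(ltrD2l (coef a 6)) addr0.
  suff -> : coef a 6 + coef e 6 = coef d 6 by exact: le_lt_trans Sa d0.
  by rewrite -eba /coef /= -eab nth_mkseq.
have pit k : p7 (iter k (bracket (root_vector a)) (s x)).
  by elim: k => //= k IH; exact: pbr.
move=> b b0; rewrite /exp_ad /=.
rewrite (big_morph (fun z : e7 => z.2 b) (id1 := 0) (op1 := +%R)) ?ffunE //.
  by apply: big1 => k _; rewrite ffunE pit ?scaler0.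
by move=> y z; rewrite ffunE.
Qed.

(* The classes X_b of the root vectors of the tangent roots form a basis of
   e7 / p7 (the fibre of T_X), so Sym (e7 / p7) is the polynomial ring in the
   X_b.  It is also the algebra of polynomials on V = (e7 / p7)^*. *)

Definition sym := {mpoly F[27]}.

(* The image of X_b; by [P7_stable_p7] an element s of P7 acts on e7 / p7, and
   only the coordinates on the tangent roots survive in the quotient. *)
Definition tangent_image (s : e7 -> e7) (b : 'I_27) : sym :=
  \sum_(c < 27) (s (root_vector (tangent_root b))).2 (tangent_root c) *: 'X_c.

Definition sym_act (s : e7 -> e7) (p : sym) : sym :=
  p \mPo [tuple tangent_image s b | b < 27].

Definition symr (r : nat) := dhomog 27 F r.

Lemma sym_act_homog r s (p : symr r) : sym_act s p \is r.-homog.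
Proof.
rewrite /sym_act comp_mpolyE big_seq; apply: rpred_sum => m mp; apply: rpredZ.
have -> : r = (\sum_(i < 27) 1 * m i)%N.
  have /dhomogP := dhomog_is_dhomog p => /(_ m mp) /= <-.
  by rewrite [LHS]mdegE; apply: eq_bigr => i _; rewrite mul1n.
elim/big_ind2: _ => [|q d q' d' hq hq'|i _]; first exact: dhomog1.
  exact: dhomogM.
apply: dhomogMn; rewrite tnth_mktuple; apply: rpred_sum => c _.
by apply: rpredZ; rewrite dhomogX /= mdeg1.
Qed.

Definition symr_act r (s : e7 -> e7) (p : symr r) : symr r :=
  DHomog (sym_act_homog s p).

Section Modules.

Variables (H : (e7 -> e7) -> Prop) (V : lmodType F).
Variable act : (e7 -> e7) -> V -> V.

Definition submodule (W : V -> Prop) : Prop :=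
  [/\ W 0, forall (c : F) u v, W u -> W v -> W (c *: u + v)
    & forall s, H s -> forall v, W v -> W (act s v)].

Definition irreducible_module (W : V -> Prop) : Prop :=
  [/\ submodule W, exists2 v, W v & v != 0
    & forall W' : V -> Prop, submodule W' -> (forall v, W' v -> W v) ->
        (forall v, W' v -> v = 0) \/ (forall v, W v -> W' v)].

Definition isomorphic_modules (W1 W2 : V -> Prop) : Prop :=
  exists f : V -> V,
    [/\ forall v, W1 v -> W2 (f v),
        forall (c : F) u v, W1 u -> W1 v -> f (c *: u + v) = c *: f u + f v,
        forall s v, H s -> W1 v -> f (act s v) = act s (f v),
        forall u v, W1 u -> W1 v -> f u = f v -> u = v
      & forall w, W2 w -> exists2 v, W1 v & f v = w].

Definition multiplicity_free : Prop :=
  forall W1 W2 : V -> Prop, irreducible_module W1 -> irreducible_module W2 ->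
    isomorphic_modules W1 W2 -> forall v, W1 v <-> W2 v.

(* With respect to the Levi part of P7, whose Borel
   subgroup is the one containing the positive root subgroups. *)
Definition highest_weight_vector (lam : weight) (v : V) : Prop :=
  [/\ v != 0,
      forall t, (forall i, t i != 0) -> act (torus t) v = character lam t *: v
    & forall a c, positive_root a -> coef a 6 = 0 -> act (exp_ad a c) v = v].

End Modules.

(* W is a copy of the irreducible P7-module E_lam. *)
Definition is_E (V : lmodType F) (act : (e7 -> e7) -> V -> V) (lam : weight)
    (W : V -> Prop) : Prop :=
  irreducible_module P7 act W /\
  exists2 v, W v & highest_weight_vector act lam v.

Definition irreducible_mpoly (p : sym) : Prop :=
  [/\ p != 0, p \isn't a GRing.unit
    & forall q1 q2, p = q1 * q2 ->
        q1 \is a GRing.unit \/ q2 \is a GRing.unit].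

Definition fundamental_highest_weight (lam : weight) : Prop :=
  exists2 h, highest_weight_vector sym_act lam h & irreducible_mpoly h.

Definition highest_weight_degree (lam : weight) (d : nat) : Prop :=
  forall h, highest_weight_vector sym_act lam h -> h \is d.-homog.

End E7.

(* Main.v *)
From HB Require Import structures.
Require Import Defs.
From mathcomp Require Import all_boot all_order all_algebra.
From mathcomp Require Import mpoly complex reals.
From mathcomp Require Import zify ring.
From mathcomp Require boolp.

Set Implicit Arguments.
Unset Strict Implicit.
Unset Printing Implicit Defensive.

Import Order.TTheory GRing.Theory Num.Theory.
Local Open Scope ring_scope.

(* The algebra generated by h1 (the variable of the highest tangent root), the
   quadric h2 and the cubic h3 contains all highest weight vectors.  Indeed the
   unipotent radical U of the Borel subgroup of the Levi part moves a point where
   h1 and h2 do not vanish to a point supported on three strongly orthogonal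
   roots (Gaussian elimination), and the torus acts transitively on the generic
   such points.  A highest weight vector f is therefore determined by its weight
   up to a scalar, and f (h1 h2 h3)^N = C h1^A h2^B h3^E; since each h_i vanishes
   at a point where the other two do not, f = c h1^i h2^j h3^k.

   Every nonzero torus- and raising-stable subspace contains a highest weight
   vector.  For the Fischer inner product the root vectors E_a and -E_(-a) are
   adjoint, so submodules generated by highest weight vectors of different
   weights are orthogonal; hence each of them is irreducible, and the orthogonal
   complement of their sum, containing no highest weight vector, is zero.

   A root vector acts by a locally nilpotent derivation, whose kernel is
   factorially closed.  Factors of h2 and h3 are thus killed by the raising
   operators, and such a factor of degree one is affine in h1, which is excluded
   by evaluating at a suitable point. *)

(** * Root data and the derivations of the Levi root vectors *)

(** No root has alpha_7-coefficient above 1, so the negative root subgroups outside the Levi part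
    act trivially on e7 / p7 and only the torus and the Levi root subgroups matter. These are
    replaced by the derivations D a of the Levi roots: D a p is read off as a coefficient of the
    polynomial exp(c D a) p in c, and the way back uses that D a is locally nilpotent.

    The facts specific to E7 are finite checks on the 27 tangent roots, decided by [vm_compute] on
    integer lists; identities between derivations are tested on the variables only.

    That 2 lambda7 occurs rather than lambda7 shows up twice: the torus element that reaches a
    generic point involves a square root, and alpha_7^vee(-1) fixes the base point, which forces the
    last coordinate of a weight to be even.

    Modules are predicates on the whole polynomial ring; finite-dimensional linear algebra enters
    only at the end, in a fixed degree. *)

Definition vneg (a : seq int) : seq int := map -%R a.

Local Notation vadd := lattice_add.

(** Stored in normal form for the later [vm_compute] checks. As [positive_roots] is built level by
    level, the list is sorted by height: index 0 is alpha_7 and index 26 the highest root. *)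
Definition tvecs : seq (seq int) :=
  Eval vm_compute in [seq a <- positive_roots | 0 < a`_6].

Definition levi_pos : seq (seq int) :=
  Eval vm_compute in [seq a <- positive_roots | a`_6 == 0].

Definition levi_neg : seq (seq int) := [seq vneg a | a <- levi_pos].

Definition levi_simple : seq (seq int) := [seq simple_root i | i <- iota 0 6].

Definition tv (n : nat) : seq int := nth [::] tvecs n.

Lemma tangent_rootsE : tangent_roots = tvecs.
Proof. by rewrite /tangent_roots rootsE; vm_compute. Qed.

Lemma val_tangent_root (b : 'I_27) : val (tangent_root b) = tv b.
Proof. by rewrite /tangent_root SubK tangent_rootsE. Qed.

Lemma tv_in (b : 'I_27) : tv b \in tvecs.
Proof. by apply: mem_nth; apply: leq_trans (ltn_ord b) _. Qed.

Lemma tvecsP v : v \in tvecs -> exists b : 'I_27, v = tv b.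
Proof. by case/(nthP [::]) => i i27 <-; exists (Ordinal (i27 : (i < 27)%N)). Qed.

Lemma tv_inj (b c : 'I_27) : tv b = tv c -> b = c.
Proof.
have ltn_size (d : 'I_27) : (d < size tvecs)%N by apply: leq_trans (ltn_ord d) _.
move/eqP; rewrite /tv nth_uniq ?ltn_size //.
by move/eqP/val_inj.
Qed.

Lemma vaddA a b c : vadd a (vadd b c) = vadd (vadd a b) c.
Proof. by rewrite /lattice_add /mkseq /= !addrA. Qed.

Lemma vaddC a b : vadd a b = vadd b a.
Proof. by apply: eq_mkseq => i; rewrite addrC. Qed.

Lemma size_vadd a b : size (vadd a b) = 7.
Proof. exact: size_mkseq. Qed.

Lemma nth_vadd a b i : (i < 7)%N -> (vadd a b)`_i = a`_i + b`_i.
Proof. exact: nth_mkseq. Qed.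

Lemma nth_vneg a i : (vneg a)`_i = - a`_i.
Proof.
have [ia|ai] := ltnP i (size a); first by rewrite (nth_map 0).
by rewrite !nth_default ?oppr0 ?size_map.
Qed.

Lemma vaddNK a e : size e = 7 -> vadd a (vadd e (vneg a)) = e.
Proof.
move=> se; apply: (@eq_from_nth _ 0) => [|i]; rewrite size_vadd ?se //.
by move=> i7; rewrite !nth_vadd // nth_vneg addrC subrK.
Qed.

Lemma vaddKN a b : size b = 7 -> vadd (vadd a b) (vneg a) = b.
Proof.
move=> se; apply: (@eq_from_nth _ 0) => [|i]; rewrite size_vadd ?se //.
by move=> i7; rewrite !nth_vadd // nth_vneg addrC addKr.
Qed.

Lemma pairing_vadd a b i : pairing (vadd a b) i = pairing a i + pairing b i.
Proof.
have pairingE v : pairing v i = \sum_(j < 7) v`_j * e7_cartan j i.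
  by rewrite -(big_mkord xpredT (fun j => v`_j * e7_cartan j i)) unlock.
rewrite !pairingE -big_split; apply: eq_bigr => j _.
by rewrite nth_vadd // mulrDl.
Qed.

(** The parity of [eps_form], written with [foldr] on plain sequences so that signs can be
    computed. *)
Definition epsz_parity (a b : seq int) : bool :=
  odd (absz (foldr (fun i s => a`_i * b`_i + s) 0 (iota 0 7) +
             foldr (fun e s => a`_(fst e) * b`_(snd e) + s) 0 e7_edges)).

Definition epsz (a b : seq int) : int := if epsz_parity a b then -1 else 1.

Lemma size_tvecs v : v \in tvecs -> size v = 7.
Proof.
move=> vt; apply/eqP; apply: (allP (_ : all (fun v => size v == 7) tvecs)) v vt.
by vm_compute.
Qed.

Section Derivations.

Variable F : numClosedFieldType.
Local Notation sym := (sym F).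

Lemma epsE (a b : Defs.root) : eps F a b = (epsz (val a) (val b))%:~R.
Proof.
rewrite /eps /eps_form; set n := (_ + _).
have -> : n = foldr (fun i s => (val a)`_i * (val b)`_i + s) 0 (iota 0 7) +
   foldr (fun (e : nat * nat) s => (val a)`_(fst e) * (val b)`_(snd e) + s) 0 e7_edges.
  congr (_ + _); last by rewrite unlock.
  by rewrite -(big_mkord xpredT (fun i => coef a i * coef b i)) unlock.
rewrite /epsz /epsz_parity; move: (_ + _) => z; case: z => k.
  by rewrite -exprnP -signr_odd /=; case: odd.
rewrite NegzE -exprz_inv invrN1 -exprnP -signr_odd /=.
by case: odd.
Qed.

(* This is 0 when v is not a tangent root. *)
Definition Xv (v : seq int) : sym := \sum_(c < 27 | tv c == v) 'X_c.

Lemma Xv_tv (b : 'I_27) : Xv (tv b) = 'X_b.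
Proof.
rewrite /Xv (eq_bigl (pred1 b)) ?big_pred1_eq // => c /=.
by apply/eqP/eqP => [/tv_inj|->].
Qed.

Lemma Xv_out v : v \notin tvecs -> Xv v = 0.
Proof.
by move=> vt; rewrite /Xv big1 // => c /eqP cv; rewrite -cv tv_in in vt.
Qed.

End Derivations.

(** The derivation extending ad E_a on e7 / p7: it sends X_b to eps(a, b) X_(a + b), or to 0 when a
    + b is not a tangent root. It is locked so that unification does not unfold the sum. *)
HB.lock Definition root_deriv (F : numClosedFieldType) (a : seq int) (p : sym F) : sym F :=
  \sum_(b < 27) (epsz a (tv b))%:~R *: (Xv F (vadd a (tv b)) * p^`M(b)).
Canonical root_deriv_unlockable := Unlockable root_deriv.unlock.

Section DerivationTheory.

Variable F : numClosedFieldType.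
Local Notation sym := (sym F).
Local Notation Xv := (Xv F).
Local Notation D := (@root_deriv F).

Lemma D_is_linear a : linear (D a).
Proof.
move=> c p q; rewrite unlock scaler_sumr -big_split; apply: eq_bigr => b _ /=.
by rewrite linearP mulrDr scalerDr -scalerAr !scalerA mulrC.
Qed.

HB.instance Definition _ a :=
  GRing.isLinear.Build F sym sym _ (D a) (D_is_linear a).

Lemma DM a p q : D a (p * q) = D a p * q + p * D a q.
Proof.
rewrite unlock mulr_suml mulr_sumr -big_split; apply: eq_bigr => b _ /=.
rewrite mderivM mulrDr scalerDr -scalerAl -scalerAr.
by congr (_ *: _ + _ *: _); [exact: mulrA | exact: mulrCA].
Qed.

Lemma DX a (b : 'I_27) : D a 'X_b = (epsz a (tv b))%:~R *: Xv (vadd a (tv b)).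
Proof.
rewrite unlock (bigD1 b) //= big1 => [|c cb].
  have UU0 : (U_(b) - U_(b) = 0)%MM by rewrite -{1}[U_(b)%MM]add0m addmK.
  by rewrite mderivX mnm1E eqxx scale1r UU0 mpolyX0 mulr1 addr0.
by rewrite mderivX mnm1E eq_sym (negPf cb) scale0r mulr0 scaler0.
Qed.

Lemma DXv a v :
  D a (Xv v) = (if v \in tvecs then (epsz a v)%:~R else 0) *: Xv (vadd a v).
Proof.
case: ifPn => [/tvecsP[b ->]|/Xv_out ->]; first by rewrite Xv_tv DX.
by rewrite linear0 scale0r.
Qed.

End DerivationTheory.

(** A derivation along [phi] is determined by its values on the variables. It is applied to
    differences of derivations: with [phi] the identity for commutators, with [phi] a substitution
    for a chain rule. *)
Lemma derivation_eq0 (F : fieldType) n (A : lalgType F)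
    (phi d : {mpoly F[n]} -> A) :
  (forall c p q, d (c *: p + q) = c *: d p + d q) ->
  (forall p q, d (p * q) = d p * phi q + phi p * d q) ->
  phi 1 = 1 ->
  (forall i, d 'X_i = 0) -> forall p, d p = 0.
Proof.
move=> dlin dmul phi1 dX.
have d0 : d 0 = 0.
  by have := dlin (-1) 0 0; rewrite scaler0 addr0 scaleN1r addNr.
have d1 : d 1 = 0.
  apply: (@addrI _ (d 1)); rewrite addr0 -{3}[1]mulr1 dmul phi1 mulr1 mul1r //.
have dM m : d 'X_[m] = 0.
  rewrite mpolyXE_id; apply: (big_ind (fun x => d x = 0)) => //.
    by move=> x y dx dy; rewrite dmul dx dy mul0r mulr0 addr0.
  move=> i _; elim: (m i) => [|k IH]; first by rewrite expr0.
  by rewrite exprS dmul dX IH mul0r mulr0 addr0.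
elim/mpolyind => [//|c m p _ _ IH].
by rewrite dlin dM IH scaler0 addr0.
Qed.

(** * The action on the symmetric algebra *)

Definition levi_roots : seq (seq int) := levi_pos ++ levi_neg.

Lemma levi_root_in (a : Defs.root) : coef a 6 = 0 -> val a \in levi_roots.
Proof.
rewrite /coef => a6.
suff /allP/(_ _ (valP a)) : all (fun a => (a`_6 == 0) ==> (a \in levi_roots)) Defs.roots.
  by rewrite a6 eqxx.
by rewrite rootsE; vm_compute.
Qed.

Lemma positive_levi_root (a : Defs.root) :
  positive_root a -> coef a 6 = 0 -> val a \in levi_pos.
Proof.
rewrite /coef /positive_root => a0 a6.
suff /allP/(_ _ (valP a)) : all (fun a => (a`_6 == 0) ==>
    all (fun x => 0 <= x) a ==> (a \in levi_pos)) Defs.roots.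
  by rewrite a6 eqxx a0.
by rewrite rootsE; vm_compute.
Qed.

Lemma levi_root_exists v : v \in levi_roots ->
  exists2 a : Defs.root, val a = v & coef a 6 = 0.
Proof.
move=> vl.
suff /allP/(_ _ vl)/andP[vr /eqP v6] :
    all (fun a => (a \in Defs.roots) && (a`_6 == 0)) levi_roots.
  by exists (SeqSub vr).
by rewrite rootsE; vm_compute.
Qed.

Lemma levi_pos_exists v : v \in levi_pos ->
  exists a : Defs.root, [/\ val a = v, positive_root a & coef a 6 = 0].
Proof.
move=> vl.
suff /allP/(_ _ vl)/and3P[vr /eqP v6 v0] :
    all (fun a => [&& a \in Defs.roots, a`_6 == 0 & all (fun x => 0 <= x) a]) levi_pos.
  by exists (SeqSub vr).
by rewrite rootsE; vm_compute.
Qed.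

Lemma root_coef7_le1 (a : Defs.root) : coef a 6 <= 1.
Proof.
suff /allP/(_ _ (valP a)) : all (fun a => a`_6 <= 1) Defs.roots by [].
by rewrite rootsE; vm_compute.
Qed.

Lemma tangent_rootP (a : Defs.root) : coef a 6 = 1 -> exists b, a = tangent_root b.
Proof.
move=> a6.
suff /tvecsP[b ab] : val a \in tvecs.
  by exists b; apply: val_inj; rewrite val_tangent_root.
by rewrite -tangent_rootsE mem_filter (valP a) -/(coef a 6) a6.
Qed.

Lemma coef_tangent_root b : coef (tangent_root b) 6 = 1.
Proof.
rewrite /coef val_tangent_root.
apply/eqP; apply: (allP (_ : all (fun v : seq int => v`_6 == 1) tvecs)) (tv_in b).
by vm_compute.
Qed.

Lemma tangent_root_inj : injective tangent_root.
Proof.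
move=> b c /(congr1 val); rewrite !val_tangent_root; exact: tv_inj.
Qed.

(** The 27-dimensional module is minuscule for the Levi part, of type E6, so root strings have at
    most two terms. Hence D a squares to zero on linear forms, where exp(c D a) is 1 + c D a. *)
Lemma levi_double_step a v : a \in levi_roots -> v \in tvecs ->
  vadd a (vadd a v) \notin tvecs.
Proof.
move=> al vt.
have /allP/(_ a al)/allP/(_ v vt) // : all (fun a =>
  all (fun v => vadd a (vadd a v) \notin tvecs) tvecs) levi_roots.
by vm_compute.
Qed.

Section Action.

Variable F : numClosedFieldType.
Local Notation sym := (sym F).
Local Notation e7 := (e7 F).
Local Notation D := (@root_deriv F).
Implicit Types (s : e7 -> e7) (p q : sym) (a : Defs.root) (c : F) (y : e7).

Lemma sym_act_is_linear s : linear (sym_act s).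
Proof. by move=> c p q; rewrite /sym_act linearP. Qed.

HB.instance Definition _ s :=
  GRing.isLinear.Build F sym sym _ (sym_act s) (sym_act_is_linear s).

Lemma sym_actM s p q : sym_act s (p * q) = sym_act s p * sym_act s q.
Proof. exact: rmorphM. Qed.

Lemma sym_act1 s : sym_act s 1 = 1.
Proof. exact: rmorph1. Qed.

Lemma sym_actXU s b : sym_act s 'X_b = tangent_image s b.
Proof. by rewrite /sym_act comp_mpolyXU (nth_map b) ?size_enum_ord // nth_ord_enum. Qed.

Lemma sym_actX s m : sym_act s 'X_[m] = \prod_(b < 27) tangent_image s b ^+ m b.
Proof.
by rewrite /sym_act comp_mpolyX; apply: eq_bigr => b _; rewrite tnth_mktuple.
Qed.

Lemma algebra_hom_ext (A : lalgType F) (f g : sym -> A) :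
  linear f -> linear g -> (forall p q, f (p * q) = f p * f q) ->
  (forall p q, g (p * q) = g p * g q) -> f 1 = 1 -> g 1 = 1 ->
  (forall b, f 'X_b = g 'X_b) -> f =1 g.
Proof.
move=> fl gl fM gM f1 g1 fg.
have h0 (h : sym -> A) : linear h -> h 0 = 0.
  by move=> hl; have := hl (-1) 0 0; rewrite scaler0 addr0 scaleN1r addNr.
have fgX m : f 'X_[m] = g 'X_[m].
  rewrite mpolyXE_id; apply: (big_ind (fun x => f x = g x)) => [||b _].
  - by rewrite f1 g1.
  - by move=> x y fx fy; rewrite fM gM fx fy.
  - by elim: (m b) => [|k IH]; rewrite ?expr0 ?f1 ?g1 // exprS fM gM fg IH.
elim/mpolyind => [|c m p _ _ IH]; first by rewrite !h0.
by rewrite fl gl fgX IH.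
Qed.

(** The projection onto e7 / p7, identified with the linear forms. *)
Definition tau (y : e7) : sym := \sum_(b < 27) y.2 (tangent_root b) *: 'X_b.

Lemma tau_is_linear : linear tau.
Proof.
move=> c x y; rewrite /tau scaler_sumr -big_split; apply: eq_bigr => b _ /=.
by rewrite !ffunE scalerDl scalerA.
Qed.

HB.instance Definition _ :=
  GRing.isLinear.Build F e7 sym _ tau tau_is_linear.

Lemma tangent_imageE s b : tangent_image s b = tau (s (root_vector F (tangent_root b))).
Proof. by []. Qed.

Lemma tau_root_vector b : tau (root_vector F (tangent_root b)) = 'X_b.
Proof.
rewrite /tau (bigD1 b) //= big1 => [|d db]; rewrite ffunE.
  by rewrite eqxx scale1r addr0.
by rewrite (inj_eq tangent_root_inj) (negPf db) scale0r.
Qed.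

Lemma tau_bracket a y (b : 'I_27) : coef a 6 <= 0 ->
  (bracket (root_vector F a) y).2 (tangent_root b) =
  \sum_(d | vadd (val a) (val d) == tv b) (epsz (val a) (val d))%:~R * y.2 d.
Proof.
move=> a0; rewrite /= ffunE.
rewrite [root_eval 0 _]big1 ?mul0r ?add0r => [|i _]; last by rewrite mxE mul0r.
rewrite !ffunE; case: eqP => [ba|_].
  by move: (coef_tangent_root b) a0; rewrite ba => ->; rewrite ler10.
rewrite mulr0 oppr0 add0r (bigD1 a) //= [X in _ + X]big1 ?addr0 => [|d da].
  rewrite -val_tangent_root; apply: eq_bigr => d _.
  by rewrite ffunE eqxx mulr1 epsE.
by apply: big1 => e _; rewrite ffunE (negPf da) mulr0 mul0r.
Qed.

Lemma tau_bracket_levi a y : coef a 6 = 0 ->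
  tau (bracket (root_vector F a) y) = D (val a) (tau y).
Proof.
move=> a0; rewrite {2}/tau linear_sum /=.
under [RHS]eq_bigr => d _ do rewrite linearZ /= DX /Xv !scaler_sumr.
rewrite (exchange_big_dep xpredT) //=; apply: eq_bigr => b _.
rewrite tau_bracket ?a0 // scaler_suml.
rewrite (reindex_onto tangent_root
  (fun d => odflt ord0 [pick b | tangent_root b == d])); last first.
  move=> d /eqP abd.
  have [|e ->] := @tangent_rootP d.
    rewrite -(coef_tangent_root b) /coef val_tangent_root -abd nth_vadd //.
    by rewrite -/(coef a 6) a0 add0r.
  by case: pickP => [e' /eqP //|/(_ e)]; rewrite eqxx.
apply: eq_big => [d|d _].
  rewrite val_tangent_root eq_sym; case: eqP => //= _.
  by case: pickP => [e'|/(_ d)]; rewrite ?eqxx // (inj_eq tangent_root_inj).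
by rewrite val_tangent_root scalerA mulrC.
Qed.

(** A root has alpha_7-coefficient at most 1, so adding one with negative coefficient never reaches
    a tangent root: the nilradical acts trivially on e7 / p7. *)
Lemma tau_bracket_neg a y : coef a 6 < 0 -> tau (bracket (root_vector F a) y) = 0.
Proof.
move=> a0; apply: big1 => b _; rewrite tau_bracket ?ltW //.
rewrite big1 ?scale0r // => d /eqP abd.
have := root_coef7_le1 d; rewrite -(lerD2l (coef a 6)) => ad1.
suff : 1 <= coef a 6 + 1 by rewrite leNgt gtrDr a0.
apply: le_trans ad1.
by rewrite -(coef_tangent_root b) /coef val_tangent_root -abd nth_vadd.
Qed.

Lemma DD_tau a y : coef a 6 = 0 -> D (val a) (D (val a) (tau y)) = 0.
Proof.
move=> a0; rewrite /tau !linear_sum; apply: big1 => b _.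
rewrite linearZ /= linearZ /= DX linearZ /= DXv Xv_out ?scaler0 ?scaler0 //.
exact: levi_double_step (levi_root_in a0) (tv_in b).
Qed.

Lemma tau_exp_ad a c y : tau (exp_ad a c y) = tau y
  + c *: tau (bracket (root_vector F a) y)
  + (c ^+ 2 / 2) *: tau (bracket (root_vector F a) (bracket (root_vector F a) y)).
Proof.
rewrite /exp_ad !big_ord_recl big_ord0 addr0 !linearD !linearZ /=.
by rewrite expr0 expr1 fact0 !factS fact0 !divr1 scale1r addrA.
Qed.

Lemma tau_exp_levi a c y : coef a 6 = 0 ->
  tau (exp_ad a c y) = tau y + c *: D (val a) (tau y).
Proof.
by move=> a0; rewrite tau_exp_ad !tau_bracket_levi // DD_tau // scaler0 addr0.
Qed.

Lemma tau_exp_neg a c y : coef a 6 < 0 -> tau (exp_ad a c y) = tau y.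
Proof.
by move=> a0; rewrite tau_exp_ad !tau_bracket_neg // !scaler0 !addr0.
Qed.

Lemma sym_act_expX a c (b : 'I_27) : coef a 6 = 0 ->
  sym_act (exp_ad a c) 'X_b = 'X_b + c *: D (val a) 'X_b.
Proof.
by move=> a0; rewrite sym_actXU tangent_imageE tau_exp_levi // tau_root_vector.
Qed.

Lemma sym_act_exp_neg a c p : coef a 6 < 0 -> sym_act (exp_ad a c) p = p.
Proof.
move=> a0; apply: (@algebra_hom_ext _ _ id) => //.
- exact: linearP.
- exact: sym_actM.
- exact: sym_act1.
by move=> b; rewrite sym_actXU tangent_imageE tau_exp_neg // tau_root_vector.
Qed.

Lemma sym_act_torusX t b : sym_act (torus t) 'X_b =
  character (root_weight (tangent_root b)) t *: ('X_b : sym).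
Proof.
rewrite sym_actXU tangent_imageE -[in RHS]tau_root_vector /tau scaler_sumr.
apply: eq_bigr => d _; rewrite /= !ffunE (inj_eq tangent_root_inj) scalerA.
by case: eqP => [->//|_]; rewrite !mulr0.
Qed.

Lemma tau_torus t y : tau (torus t y) = sym_act (torus t) (tau y).
Proof.
rewrite /tau linear_sum; apply: eq_bigr => b _.
by rewrite linearZ /= sym_act_torusX ffunE scalerA mulrC.
Qed.

Lemma tau_exp_act a c y : coef a 6 <= 0 ->
  tau (exp_ad a c y) = sym_act (exp_ad a c) (tau y).
Proof.
rewrite le_eqVlt => /orP[/eqP|] a0; last by rewrite tau_exp_neg ?sym_act_exp_neg.
rewrite tau_exp_levi // /tau !linear_sum -big_split.
apply: eq_bigr => b _; rewrite !linearZ /= sym_act_expX //.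
by rewrite scalerDr !scalerA mulrC.
Qed.

(** [sym_act] sees only the images of the tangent root vectors; the hypothesis says that the outer
    factor descends to e7 / p7. *)
Lemma sym_act_comp g s p : (forall y, tau (g y) = sym_act g (tau y)) ->
  sym_act (g \o s) p = sym_act g (sym_act s p).
Proof.
move=> tg; apply: (@algebra_hom_ext _ _ (sym_act g \o sym_act s)) => /=.
- exact: linearP.
- by move=> c x y /=; rewrite !linearP.
- exact: sym_actM.
- by move=> x y; rewrite !sym_actM.
- exact: sym_act1.
- by rewrite !sym_act1.
by move=> b; rewrite !sym_actXU !tangent_imageE /= tg.
Qed.

Lemma sym_act_id p : sym_act id p = p.
Proof.
apply: (@algebra_hom_ext _ _ id) => //.
- exact: linearP.
- exact: sym_actM.
- exact: sym_act1.
by move=> b; rewrite sym_actXU tangent_imageE tau_root_vector.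
Qed.

Lemma P7_closed (W : sym -> Prop) :
  (forall t, (forall i, t i != 0) -> forall p, W p -> W (sym_act (torus t) p)) ->
  (forall a c, coef a 6 = 0 -> forall p, W p -> W (sym_act (exp_ad a c) p)) ->
  forall s, P7 s -> forall p, W p -> W (sym_act s p).
Proof.
move=> Wt We s; elim=> {s} [|t s t0 _ IH|a c s a0 _ IH] p Wp.
- by rewrite sym_act_id.
- by rewrite sym_act_comp; [apply: Wt => //; apply: IH | exact: tau_torus].
- rewrite sym_act_comp; last by move=> y; rewrite tau_exp_act.
  move: a0; rewrite le_eqVlt => /orP[/eqP|] a0; first by apply: We => //; apply: IH.
  by rewrite sym_act_exp_neg //; apply: IH.
Qed.

Lemma levi_P7_sub s : levi_P7 s -> P7 s.
Proof.
elim=> {s} [|t s t0 _ IH|a c s /eqP a0 _ IH].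
- exact: root_subgroup_id.
- exact: root_subgroup_torus.
- by apply: root_subgroup_exp; rewrite ?a0.
Qed.

Lemma torus_in_levi t : (forall i, t i != 0) -> levi_P7 (@torus F t).
Proof. by move=> t0; apply: (root_subgroup_torus t0 (root_subgroup_id _ _)). Qed.

Lemma exp_in_levi a c : coef a 6 = 0 -> levi_P7 (exp_ad a c).
Proof.
by move=> a0; apply: (root_subgroup_exp _ _ (root_subgroup_id _ _)); rewrite ?a0.
Qed.

End Action.

(** * Group and Lie algebra actions *)

Definition subspace (F : fieldType) (V : lmodType F) (W : V -> Prop) : Prop :=
  W 0 /\ forall c u v, W u -> W v -> W (c *: u + v).

Section Subspace.

Variables (F : numFieldType) (V : lmodType F) (W : V -> Prop).
Hypothesis Wsub : subspace W.

Lemma subspaceD u v : W u -> W v -> W (u + v).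
Proof. by move=> Wu Wv; rewrite -[u]scale1r; apply: Wsub.2. Qed.

Lemma subspaceZ c u : W u -> W (c *: u).
Proof. by move=> Wu; rewrite -[_ *: _]addr0; apply: Wsub.2 => //; apply: Wsub.1. Qed.

Lemma subspaceB u v : W u -> W v -> W (u - v).
Proof. by move=> Wu Wv; rewrite -scaleN1r addrC; apply: Wsub.2. Qed.

Lemma subspace_sum I (r : seq I) (P : pred I) (f : I -> V) :
  (forall i, P i -> W (f i)) -> W (\sum_(i <- r | P i) f i).
Proof. by move=> Wf; apply: big_ind => //; [apply: Wsub.1 | apply: subspaceD]. Qed.

Lemma subspaceZ_inv c u : c != 0 -> W (c *: u) -> W u.
Proof. by move=> c0 /(subspaceZ c^-1); rewrite scalerA mulVf // scale1r. Qed.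

(** The value at 2c minus 2^N times the value at c kills the top coefficient and multiplies the k-th
    by 2^k - 2^N, which is nonzero for k < N; then induction applies. This replaces differentiating
    a one-parameter subgroup at 0. *)
Lemma subspace_coefficients N (v : nat -> V) :
  (forall c : F, W (\sum_(k < N) c ^+ k *: v k)) -> forall k, (k < N)%N -> W (v k).
Proof.
elim: N v => [|N IH] v Wv k; first by rewrite ltn0.
have Wlt j : (j < N)%N -> W (v j).
  move=> jN; apply: (@subspaceZ_inv (2 ^+ j - 2 ^+ N)).
    by rewrite subr_eq0 lt_eqF // ltr_eXn2l ?ltr1n.
  apply: (IH (fun k => (2 ^+ k - 2 ^+ N) *: v k)) jN => c.
  have := subspaceB (Wv (2 * c)) (subspaceZ (2 ^+ N) (Wv c)).
  rewrite !big_ord_recr /= scalerDr opprD addrACA !scalerA exprMn subrr addr0.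
  rewrite scaler_sumr -sumrB; congr W; apply: eq_bigr => i _.
  by rewrite !scalerA -scalerBl exprMn mulrBr [c ^+ i * 2 ^+ i]mulrC [c ^+ i * 2 ^+ N]mulrC.
rewrite ltnS leq_eqVlt => /orP[/eqP ->|]; last exact: Wlt.
have := Wv 1; rewrite big_ord_recr /= expr1n scale1r => W1.
suff WS : W (\sum_(i < N) 1 ^+ i *: v i).
  by have := subspaceB W1 WS; rewrite addrAC subrr add0r.
by apply: subspace_sum => i _; apply/subspaceZ/Wlt.
Qed.

End Subspace.

Inductive span_of (F : fieldType) (V : lmodType F) (P : V -> Prop) : V -> Prop :=
| span_of0 : span_of P 0
| span_of_cons c p q : P p -> span_of P q -> span_of P (c *: p + q).

Lemma span_of_mem (F : fieldType) (V : lmodType F) (P : V -> Prop) p :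
  P p -> span_of P p.
Proof.
by move=> Pp; rewrite -[p]addr0 -[p]scale1r; apply: span_of_cons Pp (span_of0 _).
Qed.

Lemma span_of_subspace (F : fieldType) (V : lmodType F) (P : V -> Prop) :
  subspace (span_of P).
Proof.
split; first exact: span_of0.
move=> c u v Pu Pv; elim: Pu => [|d p q Pp _ IH]; first by rewrite scaler0 add0r.
by rewrite scalerDr scalerA -addrA; apply: span_of_cons.
Qed.

Lemma span_of_min (F : fieldType) (V : lmodType F) (P W : V -> Prop) :
  subspace W -> (forall p, P p -> W p) -> forall p, span_of P p -> W p.
Proof. by case=> W0 Wl PW p; elim=> // c q r Pq _; apply: Wl; apply: PW. Qed.

Lemma subspace_preim (F : fieldType) (U V : lmodType F) (W : V -> Prop)
    (f : {linear U -> V}) : subspace W -> subspace (fun u => W (f u)).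
Proof. by case=> W0 Wl; split=> [|c u v]; rewrite ?linear0 ?linearP //; apply: Wl. Qed.

(** * Exponentials of the Levi root derivations *)

Section Exponential.

Variable F : numClosedFieldType.
Local Notation sym := (sym F).
Local Notation D := (@root_deriv F).
Implicit Types (p q : sym) (a : Defs.root) (c : F).

Lemma iter_D_linear v k c p q :
  iter k (D v) (c *: p + q) = c *: iter k (D v) p + iter k (D v) q.
Proof. by elim: k => //= k ->; rewrite linearP. Qed.

Lemma iter_D0 v k : iter k (D v) 0 = 0.
Proof. by elim: k => //= k ->; rewrite linear0. Qed.

(** Two terms of the Leibniz formula survive, because D v applied twice kills the variable. *)
Lemma iter_DXM v (b : 'I_27) k q : D v (D v 'X_b) = 0 ->
  iter k.+1 (D v) ('X_b * q) =
  'X_b * iter k.+1 (D v) q + k.+1%:R *: (D v 'X_b * iter k (D v) q).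
Proof.
move=> DD; elim: k => [|k IH]; first by rewrite /= DM addrC scale1r.
rewrite iterS IH linearD linearZ /= !DM DD mul0r add0r.
rewrite -[k.+2%:R]natr1 scalerDl scale1r.
by rewrite [LHS]addrC [LHS]addrA [LHS]addrC.
Qed.

Definition exp_D v c N p := \sum_(k < N) (c ^+ k / k`!%:R) *: iter k (D v) p.

Lemma exp_D_linear v c N d p q :
  exp_D v c N (d *: p + q) = d *: exp_D v c N p + exp_D v c N q.
Proof.
rewrite /exp_D scaler_sumr -big_split; apply: eq_bigr => k _.
by rewrite iter_D_linear scalerDr !scalerA mulrC.
Qed.

(** Multiplicativity of the exponential when one factor is a variable; the series of that factor has
    two terms, so the truncation order rises by one. *)
Lemma exp_DXM v c N (b : 'I_27) q : D v (D v 'X_b) = 0 -> iter N (D v) q = 0 ->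
  exp_D v c N.+1 ('X_b * q) = ('X_b + c *: D v 'X_b) * exp_D v c N q.
Proof.
move=> DD DN; rewrite mulrDl.
have -> : 'X_b * exp_D v c N q = \sum_(k < N.+1) (c ^+ k / k`!%:R) *: ('X_b * iter k (D v) q).
  rewrite big_ord_recr /= DN mulr0 scaler0 addr0 /exp_D mulr_sumr.
  by apply: eq_bigr => k _; rewrite scalerAr.
rewrite /exp_D !big_ord_recl /= -addrA; congr (_ + _).
rewrite mulr_sumr -big_split; apply: eq_bigr => k _ /=.
rewrite -iterS iter_DXM // scalerDr; congr (_ + _).
rewrite -scalerAl -scalerAr !scalerA; congr (_ *: _).
rewrite /bump leq0n add1n factS natrM exprS -!mulrA; congr (_ * (_ * _)).
by rewrite add0n invfM mulrAC mulVf ?mul1r // pnatr_eq0.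
Qed.

Lemma exp_D_trunc v c N M p : (N <= M)%N -> iter N (D v) p = 0 ->
  exp_D v c M p = exp_D v c N p.
Proof.
move=> NM DN; rewrite /exp_D.
rewrite -!(big_mkord xpredT (fun k => (c ^+ k / k`!%:R) *: iter k (D v) p)).
rewrite [LHS](@big_cat_nat _ _ _ N) //= [X in _ + X]big_nat [X in _ + X]big1 ?addr0 // => k.
by case/andP=> Nk _; rewrite -(subnK Nk) iterD DN iter_D0 scaler0.
Qed.

Lemma DDX (b : 'I_27) a : coef a 6 = 0 -> D (val a) (D (val a) 'X_b) = 0.
Proof.
by move=> a0; have := @DD_tau F a (root_vector F (tangent_root b)) a0; rewrite tau_root_vector.
Qed.

(** Each variable is killed by the square of D a, so a monomial of degree d is killed by the power d
    + 1. The exponential formula is proved along with this, since its induction step needs the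
    nilpotency of the smaller monomial. *)
Lemma iter_D_monomial a m N : coef a 6 = 0 -> (mdeg m < N)%N ->
  iter N (D (val a)) 'X_[m] = 0 /\
  forall c, sym_act (exp_ad a c) 'X_[m] = exp_D (val a) c N 'X_[m].
Proof.
move=> a0; have [d] := ubnP (mdeg m); elim: d m N => // d IH m N; rewrite ltnS => md mN.
have [m0|m0] := eqVneq m 0%MM.
  rewrite m0 mpolyX0; case: N mN => // N _.
  have D1 : D (val a) 1 = 0.
    by apply: (@addrI _ (D (val a) 1)); rewrite addr0 -{3}[1]mulr1 DM mulr1 mul1r.
  split=> [|c]; first by rewrite iterSr D1 iter_D0.
  rewrite sym_act1 (@exp_D_trunc _ _ 1) //.
  by rewrite /exp_D big_ord1 expr0 fact0 divr1 scale1r.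
have [b mb] : exists b, m b != 0%N.
  apply/existsP; apply: contraNT m0 => /existsPn m0.
  by apply/eqP/mnmP => b; rewrite mnm0E; apply/eqP; rewrite -[_ == _]negbK m0.
pose m' := (m - U_(b))%MM.
have mE : m = (U_(b) + m')%MM by rewrite addmC submK // lep1mP.
have dm : mdeg m = (mdeg m').+1 by rewrite {1}mE mdegD mdeg1.
case: N mN => // N; rewrite dm ltnS => mN; rewrite dm in md.
have [D0 eD] := IH m' N md mN.
split=> [|c].
  by rewrite mE mpolyXD iter_DXM ?DDX // iterS D0 linear0 !mulr0 scaler0 addr0.
by rewrite mE mpolyXD sym_actM eD exp_DXM ?DDX // sym_act_expX.
Qed.

Lemma sym_act_exp a c N p : coef a 6 = 0 -> (msize p <= N)%N ->
  sym_act (exp_ad a c) p = exp_D (val a) c N p.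
Proof.
move=> a0 pN; rewrite [p]mpolyE big_seq.
have eD0 : exp_D (val a) c N 0 = 0 by apply: big1 => k _; rewrite iter_D0 scaler0.
apply: (big_ind (fun p => sym_act (exp_ad a c) p = exp_D (val a) c N p)).
- by rewrite linear0.
- move=> q r Hq Hr; have -> : q + r = 1 *: q + r by rewrite scale1r.
  by rewrite exp_D_linear linearP /= Hq Hr.
move=> m mp; rewrite -[_ *: _]addr0 exp_D_linear linearP /= linear0 eD0.
have mN : (mdeg m < N)%N by apply: leq_trans pN; apply: msize_mdeg_lt.
by have [_ ->] := iter_D_monomial a0 mN.
Qed.

Lemma sym_act_exp_fixed a c p : coef a 6 = 0 -> D (val a) p = 0 ->
  sym_act (exp_ad a c) p = p.
Proof.
move=> a0 Dp; rewrite (sym_act_exp _ a0 (leqnSn _)) (@exp_D_trunc _ _ 1) //.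
by rewrite /exp_D big_ord1 expr0 fact0 divr1 scale1r.
Qed.

Lemma closed_exp_D (W : sym -> Prop) a : subspace W -> coef a 6 = 0 ->
  (forall c p, W p -> W (sym_act (exp_ad a c) p)) ->
  forall p, W p -> W (D (val a) p).
Proof.
move=> Wsub a0 We p Wp.
(* The coefficient of index 1 is D p; the order [(msize p).+2] makes this index admissible for every
   [p]. *)
have := @subspace_coefficients _ _ _ Wsub (msize p).+2
  (fun k => k`!%:R^-1 *: iter k (D (val a)) p) _ 1 isT.
rewrite invr1 scale1r; apply => c.
have := We c p Wp; rewrite (@sym_act_exp _ _ (msize p).+2) //; last exact: leqW.
by congr W; apply: eq_bigr => k _; rewrite scalerA.
Qed.

Lemma closed_D_exp (W : sym -> Prop) a : subspace W -> coef a 6 = 0 ->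
  (forall p, W p -> W (D (val a) p)) ->
  forall c p, W p -> W (sym_act (exp_ad a c) p).
Proof.
move=> Wsub a0 WD c p Wp; rewrite (sym_act_exp _ a0 (leqnn _)).
apply: (subspace_sum Wsub) => k _; apply: (subspaceZ Wsub).
by elim: (val k) => //= j; apply: WD.
Qed.

End Exponential.

(** * Weights *)

Definition vec_weight (v : seq int) : weight := \row_(i < 7) pairing v i.

Lemma vec_weightD u v : vec_weight (vadd u v) = vec_weight u + vec_weight v.
Proof. by apply/rowP => i; rewrite !mxE pairing_vadd. Qed.

Definition wt (m : 'X_{1..27}) : weight := \sum_(b < 27) vec_weight (tv b) *+ m b.

Lemma wtD m n : wt (m + n) = wt m + wt n.
Proof. by rewrite /wt -big_split; apply: eq_bigr => b _; rewrite mnmDE mulrnDr. Qed.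

Lemma wtU b : wt U_(b) = vec_weight (tv b).
Proof.
rewrite /wt (bigD1 b) //= mnm1E eqxx big1 ?addr0 // => c cb.
by rewrite mnm1E eq_sym (negPf cb).
Qed.

Section Characters.

Variable F : numFieldType.
Implicit Types (t : 'I_7 -> F) (mu nu : weight).

Lemma character0 t : character 0 t = 1.
Proof. by apply: big1 => i _; rewrite mxE expr0z. Qed.

Lemma characterD t mu nu : (forall i, t i != 0) ->
  character (mu + nu) t = character mu t * character nu t.
Proof.
move=> t0; rewrite /character -big_split; apply: eq_bigr => i _ /=.
by rewrite mxE expfzDr.
Qed.

Lemma characterMn t mu n : (forall i, t i != 0) ->
  character (mu *+ n) t = character mu t ^+ n.
Proof.
move=> t0; elim: n => [|n IH]; first by rewrite mulr0n character0 expr0.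
by rewrite mulrS exprS characterD ?IH.
Qed.

(** The point alpha_i^vee(2) of the torus. As 2 has infinite order, a character at this point
    recovers the i-th coordinate of its weight. *)
Definition torus2 (i : 'I_7) (j : 'I_7) : F := if j == i then 2 else 1.

Lemma torus2_neq0 i j : torus2 i j != 0.
Proof. by rewrite /torus2; case: ifP => _; rewrite ?oner_eq0 // pnatr_eq0. Qed.

Lemma character_torus2 i mu : character mu (torus2 i) = 2 ^ mu 0 i.
Proof.
rewrite /character (bigD1 i) //= /torus2 eqxx big1 ?mulr1 // => j /negPf ->.
by rewrite exp1rz.
Qed.

Lemma expz2_inj : injective (exprz (2 : F)).
Proof.
have two0 : 2 != 0 :> F by rewrite pnatr_eq0.
have expn1 n : (2 : F) ^+ n = 1 -> n = 0%N.
  case: n => // n /eqP; rewrite gt_eqF // -(expr0 2) ltr_eXn2l ?ltr1n //.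
move=> a b ab; apply/eqP; rewrite -subr_eq0; apply/eqP.
have : (2 : F) ^ (a - b) = 1 by rewrite expfzDr // ab -expfzDr // subrr expr0z.
case: (a - b) => n; first by move/expn1 ->.
by rewrite NegzE -invr_expz => /eqP; rewrite invr_eq1 => /eqP/expn1.
Qed.

Lemma character_torus2_inj i mu nu :
  character mu (torus2 i) = character nu (torus2 i) -> mu 0 i = nu 0 i.
Proof. by rewrite !character_torus2 => /expz2_inj. Qed.

Lemma character_separates mu nu : mu != nu ->
  exists2 t : 'I_7 -> F, forall i, t i != 0 & character mu t != character nu t.
Proof.
move=> mn; have /existsP[i mni] : [exists i, mu 0 i != nu 0 i].
  apply: contraNT mn => /existsPn eqi; apply/eqP/rowP => i; apply/eqP.
  by rewrite -[_ == _]negbK eqi.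
exists (torus2 i); first exact: torus2_neq0.
by apply: contraNneq mni => /character_torus2_inj ->.
Qed.

End Characters.

(** The coefficient of X_(u + v + c) in the commutator of D u and D v applied to X_c. *)
Definition comm_coef (u v c : seq int) : int :=
  (if vadd v c \in tvecs then epsz v c * epsz u (vadd v c) else 0) -
  (if vadd u c \in tvecs then epsz u c * epsz v (vadd u c) else 0).

(** Meant for a = a' + i: the relation [D a', D i] = epsz(a', i) D a, tested on the variables. When
    a + c is not a tangent root both sides vanish at X_c. *)
Definition commutator_check (a' i a : seq int) : bool :=
  all (fun c => (vadd a c \in tvecs) ==>
    (comm_coef a' i c == epsz a' i * epsz a c)) tvecs.

Section Weights.

Variable F : numClosedFieldType.
Local Notation sym := (sym F).
Local Notation D := (@root_deriv F).
Implicit Types (p q : sym) (mu nu : weight) (t : 'I_7 -> F).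

Lemma sym_act_torus_monomial t m : (forall i, t i != 0) ->
  sym_act (torus t) 'X_[m] = character (wt m) t *: ('X_[m] : sym).
Proof.
move=> t0; rewrite sym_actX.
under eq_bigr => b _ do rewrite -sym_actXU sym_act_torusX exprZn.
rewrite scaler_prod -mpolyXE_id; congr (_ *: _).
rewrite /wt (big_morph (fun mu => character mu t) (id1 := 1) (op1 := *%R)).
- apply: eq_bigr => b _; rewrite characterMn //; congr (character _ _ ^+ _).
  by apply/rowP => j; rewrite !mxE val_tangent_root.
- by move=> mu nu; apply: characterD.
- exact: character0.
Qed.

Lemma mcoeff_torus t p m : (forall i, t i != 0) ->
  (sym_act (torus t) p)@_m = character (wt m) t * p@_m.
Proof.
move=> t0; elim/mpolyind: p => [|c n p _ _ IH].
  by rewrite linear0 mcoeff0 mulr0.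
rewrite linearP /= sym_act_torus_monomial // !mcoeffD !mcoeffZ IH mulrDr mcoeffX.
by rewrite mulrCA; case: eqP => [->|_]; rewrite ?mulr0.
Qed.

(** Stated on the support, which suits the monomial arguments; the equivalent torus form makes
    products immediate. *)
Definition has_weight mu p : Prop := {in msupp p, forall m, wt m = mu}.

Lemma has_weightP mu p :
  has_weight mu p <->
  forall t, (forall i, t i != 0) -> sym_act (torus t) p = character mu t *: p.
Proof.
split=> [pmu t t0|pt m].
  apply/mpolyP => m; rewrite mcoeff_torus // mcoeffZ.
  have [/pmu -> //|/memN_msupp_eq0 ->] := boolP (m \in msupp p).
  by rewrite !mulr0.
rewrite mcoeff_msupp => pm; apply/eqP; apply/negPn/negP.
case/(character_separates F) => t t0 /eqP; apply; apply: (mulIf pm).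
by rewrite -mcoeff_torus // pt // mcoeffZ.
Qed.

Lemma has_weight_uniq mu nu p : p != 0 -> has_weight mu p -> has_weight nu p -> mu = nu.
Proof. by move=> p0 /(_ _ (mlead_supp p0)) <- /(_ _ (mlead_supp p0)). Qed.

Lemma has_weightM mu nu p q :
  has_weight mu p -> has_weight nu q -> has_weight (mu + nu) (p * q).
Proof.
move=> /has_weightP pm /has_weightP qn; apply/has_weightP => t t0.
by rewrite sym_actM pm // qn // characterD // -scalerAl -scalerAr scalerA.
Qed.

Lemma has_weight1 : has_weight 0 (1 : sym).
Proof. by apply/has_weightP => t _; rewrite sym_act1 character0 scale1r. Qed.

Lemma has_weightX mu p n : has_weight mu p -> has_weight (mu *+ n) (p ^+ n).
Proof.
move=> pm; elim: n => [|n IH]; first exact: has_weight1.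
by rewrite exprS mulrS; apply: has_weightM.
Qed.

Lemma has_weightZ mu c p : has_weight mu p -> has_weight mu (c *: p).
Proof. by move=> pm m /msuppZ_le /pm. Qed.

(** Unwanted weights nu are removed one at a time: for t separating nu from mu, the operator t -
    nu(t) kills the nu-component and multiplies the mu-component by a nonzero scalar. The list L
    contains the weights still to be removed. *)
Lemma weight_component (W : sym -> Prop) mu p : subspace W ->
  (forall t, (forall i, t i != 0) -> forall q, W q -> W (sym_act (torus t) q)) ->
  W p -> exists2 q, W q & forall m, q@_m = if wt m == mu then p@_m else 0.
Proof.
move=> Wsub Wt.
have : exists L : seq weight, {in msupp p, forall m, (wt m == mu) || (wt m \in L)}.
  exists [seq wt m | m <- msupp p] => m mp.
  by rewrite map_f ?orbT.
case=> L; elim: L p => [|nu L IH] p pL Wp.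
  exists p => // m; case: eqP => // wm; apply: memN_msupp_eq0.
  by apply/negP => /pL; rewrite orbF => /eqP.
have [nm|nm] := eqVneq nu mu.
  by apply: IH => // m /pL; rewrite inE nm orbA orbb.
have [t t0 tmn] := character_separates F nm.
pose p' := sym_act (torus t) p - character nu t *: p.
have p'E m : p'@_m = (character (wt m) t - character nu t) * p@_m.
  by rewrite mcoeffB mcoeffZ mcoeff_torus // mulrBl.
have [|| q Wq qE] := IH p'.
- move=> m; rewrite mcoeff_msupp p'E mulf_eq0 negb_or subr_eq0 => /andP[wm pm].
  move: (pL m); rewrite mcoeff_msupp => /(_ pm); rewrite inE.
  by case: (wt m =P nu) wm => [->|]; rewrite ?eqxx.
- apply: (subspaceB Wsub); first exact: Wt.
  exact: (subspaceZ Wsub).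
exists ((character mu t - character nu t)^-1 *: q); first exact: (subspaceZ Wsub).
move=> m; rewrite mcoeffZ qE p'E; case: eqP => [->|]; last by rewrite mulr0.
by rewrite mulKf // subr_eq0 eq_sym.
Qed.

Lemma msupp_D v p m : m \in msupp (D v p) ->
  exists (b e : 'I_27) n,
    [/\ vadd v (tv b) = tv e, (n + U_(b))%MM \in msupp p & m = (n + U_(e))%MM].
Proof.
rewrite unlock => /msupp_sum_le/flatten_mapP[b _].
move=> /msuppZ_le.
have [/tvecsP[e be]|/Xv_out ->] := boolP (vadd v (tv b) \in tvecs); last first.
  by rewrite mul0r msupp0.
rewrite be Xv_tv mulrC (perm_mem (msuppMX _ _)) => /mapP[n np ->].
exists b, e, n; split=> //; last exact: addmC.
move: np; rewrite !mcoeff_msupp mcoeff_deriv.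
by apply: contraNneq => ->; rewrite mul0rn.
Qed.

Lemma has_weight_D mu v p : has_weight mu p -> has_weight (mu + vec_weight v) (D v p).
Proof.
move=> pm m /msupp_D[b [e [n [be np ->]]]].
by rewrite -(pm _ np) !wtD !wtU -be vec_weightD addrAC addrA.
Qed.

Lemma dhomog_D d v p : p \is d.-homog -> D v p \is d.-homog.
Proof.
move=> /dhomogP pd; apply/dhomogP => m /msupp_D[b [e [n [_ np ->]]]].
by rewrite -(pd _ np) !mfD /= !mdeg1.
Qed.

(** The commutator of two derivations is a derivation, hence determined by the variables. *)
Lemma commutator_ext u v (E : {linear sym -> sym}) :
  (forall p q, E (p * q) = E p * q + p * E q) ->
  (forall c : 'I_27, D u (D v 'X_c) - D v (D u 'X_c) = E 'X_c) ->
  forall p, D u (D v p) - D v (D u p) = E p.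
Proof.
move=> EM EX p; apply/eqP; rewrite -subr_eq0; apply/eqP.
apply: (@derivation_eq0 _ _ _ id (fun p => D u (D v p) - D v (D u p) - E p)) => //.
- move=> c q r; rewrite !linearP /= !scalerDr !scalerN; ring.
- move=> q r; rewrite EM !DM !linearD /= !DM; ring.
- by move=> i; rewrite EX subrr.
Qed.


Lemma commutatorX u v (c : 'I_27) :
  D u (D v 'X_c) - D v (D u 'X_c) =
  (comm_coef u v (tv c))%:~R *: Xv F (vadd (vadd u v) (tv c)).
Proof.
rewrite /comm_coef !DX [D u _]linearZ [D v _]linearZ /= !DXv !scalerA rmorphB scalerBl /=.
rewrite [vadd u (vadd v _)]vaddA [vadd v (vadd u _)]vaddA [vadd v u]vaddC.
by congr (_ *: _ - _ *: _); case: ifP => _; rewrite ?mulr0 ?rmorph0 // rmorphM.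
Qed.

Lemma commutator_checkP a' i p : commutator_check a' i (vadd a' i) ->
  D (vadd a' i) p = (epsz a' i)%:~R *: (D a' (D i p) - D i (D a' p)).
Proof.
move=> /allP gc; pose E := GRing.scale (epsz a' i)%:~R \o D (vadd a' i).
have ss : (epsz a' i)%:~R * (epsz a' i)%:~R = 1 :> F.
  by rewrite /epsz; case: epsz_parity; rewrite ?rmorphN1 ?mulrNN mulr1.
have EM q r : E (q * r) = E q * r + q * E r.
  by rewrite /E /= DM scalerDr -scalerAl -scalerAr.
rewrite (@commutator_ext _ _ E) // /E /= ?scalerA ?ss ?scale1r // => c.
rewrite commutatorX DX scalerA -rmorphM.
have [aT|/Xv_out ->] := boolP (vadd (vadd a' i) (tv c) \in tvecs); last by rewrite !scaler0.
by have := gc _ (tv_in c); rewrite aT => /eqP ->.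
Qed.

End Weights.

(** * Highest weight vectors and the modules they generate *)

(* Every positive Levi root derivation is, up to sign, an iterated commutator of
   the six simple ones, so invariance is only ever computed for simple roots. *)
Definition commutator_levels (l s : seq (seq int)) : bool :=
  all (fun k => let a := nth [::] l k in (a \in s) ||
    has (fun i => let a' := vadd a (vneg i) in
      [&& (index a' l < k)%N, vadd a' i == a & commutator_check a' i a]) s)
    (iota 0 (size l)).

Lemma commutator_levels_ind (F : numClosedFieldType) l s (P : seq int -> Prop) :
  commutator_levels l s ->
  (forall i, i \in s -> P i) ->
  (forall a a' i c, P a' -> P i ->
    (forall p, @root_deriv F a p =
       c *: (root_deriv a' (root_deriv i p) - root_deriv i (root_deriv a' p))) -> P a) ->
  forall a, a \in l -> P a.
Proof.
move=> /allP gl Ps Pc a; have [k] := ubnP (index a l); elim: k a => // k IH a.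
rewrite ltnS => ak al.
have /= := gl (index a l); rewrite mem_iota index_mem al nth_index // => /(_ isT).
case/orP=> [/Ps //|/hasP[i si /and3P[ia /eqP aE gc]]].
apply: (Pc a (vadd a (vneg i)) i (epsz (vadd a (vneg i)) i)%:~R).
- apply: IH; first exact: leq_trans ia ak.
  by rewrite -index_mem (leq_trans ia) // ltnW // index_mem.
- exact: Ps.
by move=> p; rewrite -commutator_checkP aE.
Qed.

Definition levi_simple_neg : seq (seq int) := [seq vneg a | a <- levi_simple].

Lemma levi_pos_levels : commutator_levels levi_pos levi_simple.
Proof. by vm_compute. Qed.

Lemma levi_neg_levels : commutator_levels levi_neg levi_simple_neg.
Proof. by vm_compute. Qed.

Lemma levi_simple_pos v : v \in levi_simple -> v \in levi_pos.
Proof. by move=> vs; apply: (allP (_ : all (mem levi_pos) levi_simple)). Qed.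

Lemma levi_simple_neg_roots v : v \in levi_simple_neg -> v \in levi_roots.
Proof. by move=> vs; apply: (allP (_ : all (mem levi_roots) levi_simple_neg)). Qed.

Lemma levi_pos_roots v : v \in levi_pos -> v \in levi_roots.
Proof. by rewrite mem_cat => ->. Qed.

(** The tangent roots are listed by increasing height. *)
Lemma simple_raises v (b e : 'I_27) : v \in levi_simple ->
  vadd v (tv b) = tv e -> (b < e)%N.
Proof.
move=> vs /eqP be.
have /allP/(_ _ vs)/allP/(_ b) : all (fun v => all (fun b => all (fun e =>
   (vadd v (tv b) == tv e) ==> (b < e)%N) (iota 0 27)) (iota 0 27)) levi_simple.
  by vm_compute.
rewrite mem_iota => /(_ (ltn_ord b))/allP/(_ e).
by rewrite mem_iota => /(_ (ltn_ord e))/implyP; apply.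
Qed.

Section HighestWeights.

Variable F : numClosedFieldType.
Local Notation sym := (sym F).
Local Notation D := (@root_deriv F).
Implicit Types (p q : sym) (mu nu : weight) (t : 'I_7 -> F).

(** The action of the coroot alpha_j^vee on the polynomial ring; up to sign it is the commutator of
    the raising and lowering operators of alpha_j. *)
Definition weight_derivation (j : 'I_7) p : sym :=
  \sum_(b < 27) (pairing (tv b) j)%:~R *: ('X_b * p^`M(b)).

Lemma weight_derivation_is_linear j : linear (weight_derivation j).
Proof.
move=> c p q; rewrite /weight_derivation scaler_sumr -big_split.
apply: eq_bigr => b _ /=.
by rewrite linearP mulrDr scalerDr -scalerAr !scalerA mulrC.
Qed.

HB.instance Definition _ j :=
  GRing.isLinear.Build F sym sym _ _ (weight_derivation_is_linear j).

Lemma weight_derivationM j p q :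
  weight_derivation j (p * q) = weight_derivation j p * q + p * weight_derivation j q.
Proof.
rewrite /weight_derivation mulr_suml mulr_sumr -big_split; apply: eq_bigr => b _ /=.
rewrite mderivM mulrDr scalerDr -scalerAl -scalerAr.
by congr (_ *: _ + _ *: _); [exact: mulrA | exact: mulrCA].
Qed.

Lemma weight_derivation_monomial j m :
  weight_derivation j 'X_[m] = (wt m 0 j)%:~R *: 'X_[m].
Proof.
rewrite /wt summxE rmorph_sum scaler_suml; apply: eq_bigr => b _.
rewrite mderivX -scalerAr scalerA mulmxnE mxE /= rmorphMn /= mulr_natr.
have [mb|mb] := eqVneq (m b) 0%N; first by rewrite mb !mulr0n !scale0r.
by rewrite -mpolyXD addmC submK // lep1mP.
Qed.

Lemma weight_derivationE j mu p : has_weight mu p ->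
  weight_derivation j p = (mu 0 j)%:~R *: p.
Proof.
move=> pm; rewrite {1 2}[p]mpolyE linear_sum scaler_sumr big_seq [RHS]big_seq.
apply: eq_bigr => m /pm <-.
by rewrite linearZ /= weight_derivation_monomial !scalerA mulrC.
Qed.

(** The Chevalley relations between simple raising and lowering operators of the Levi part, with the
    signs of [epsz]. *)
Definition simple_commutator_check : bool :=
  all (fun i => all (fun j => all (fun c =>
    let u := simple_root i in let v := vneg (simple_root j) in
    if i == j then (vadd (vadd u v) c == c) && (comm_coef u v c == epsz u v * pairing c i)
    else (vadd (vadd u v) c \in tvecs) ==> (comm_coef u v c == 0))
  tvecs) (iota 0 6)) (iota 0 6).

Lemma simple_commutatorP : simple_commutator_check.
Proof. by vm_compute. Qed.

Lemma simple_commutator u v mu p : u \in levi_simple -> v \in levi_simple_neg ->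
  has_weight mu p -> exists c, D u (D v p) - D v (D u p) = c *: p.
Proof.
move=> /mapP[i i6 ->] /mapP[_ /mapP[j j6 ->] ->] pm.
have /allP/(_ _ i6)/allP/(_ _ j6)/allP chk := simple_commutatorP.
case: (eqVneq i j) chk => [<-{j j6}|ij] chk.
  have i7 : (i < 7)%N by move: i6; rewrite mem_iota => /andP[_ /ltnW].
  set k := epsz (simple_root i) (vneg (simple_root i)) in chk *.
  pose E := GRing.scale k%:~R \o weight_derivation (Ordinal i7).
  have EM q r : E (q * r) = E q * r + q * E r.
    by rewrite /E /= weight_derivationM scalerDr -scalerAl -scalerAr.
  exists (k%:~R * (mu 0 (Ordinal i7))%:~R).
  rewrite (@commutator_ext _ _ _ E) // => [|c].
    by rewrite /E /= (weight_derivationE _ pm) scalerA.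
  have /andP[/eqP cE /eqP kE] := chk _ (tv_in c).
  rewrite commutatorX cE Xv_tv kE /E /= weight_derivation_monomial wtU mxE.
  by rewrite rmorphM scalerA.
exists 0; rewrite scale0r.
pose E : {linear sym -> sym} := GRing.scale 0 \o idfun.
have E0 q : E q = 0 by rewrite /E /= scale0r.
rewrite -[RHS](E0 p); apply: commutator_ext => [q r|c].
  by rewrite !E0 mul0r mulr0 addr0.
rewrite commutatorX E0.
have /= := chk _ (tv_in c).
set w := vadd _ _; have [_ /eqP ->|/Xv_out -> _] := boolP (w \in tvecs).
  by rewrite scale0r.
by rewrite scaler0.
Qed.

Lemma killed_by_levi_pos p : (forall v, v \in levi_simple -> D v p = 0) ->
  forall v, v \in levi_pos -> D v p = 0.
Proof.
move=> Dp; apply: (@commutator_levels_ind F _ _ _ levi_pos_levels Dp) => a a' i c D1 D2 ->.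
by rewrite D1 D2 !linear0 addr0 scaler0.
Qed.

(** A termination measure: a simple raising operator replaces a variable by one of larger index,
    which contributes less. *)
Definition depth (m : 'X_{1..27}) : nat := (\sum_(b < 27) m b * (27 - b))%N.

Lemma depthD m n : depth (m + n) = (depth m + depth n)%N.
Proof. by rewrite /depth -big_split; apply: eq_bigr => b _; rewrite mnmDE mulnDl. Qed.

Lemma depthU b : depth U_(b) = (27 - b)%N.
Proof.
rewrite /depth (bigD1 b) //= mnm1E eqxx mul1n big1 ?addn0 // => c cb.
by rewrite mnm1E eq_sym (negPf cb).
Qed.

(** The component of p of the weight of its leading monomial is nonzero and lies in W. Raising
    operators are applied to it as long as the result is nonzero; the bound N on the depth drops
    each time. *)
Lemma exists_highest_weight (W : sym -> Prop) p : subspace W ->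
  (forall t, (forall i, t i != 0) -> forall q, W q -> W (sym_act (torus t) q)) ->
  (forall v, v \in levi_simple -> forall q, W q -> W (D v q)) ->
  W p -> p != 0 ->
  exists w mu, [/\ W w, w != 0, has_weight mu w
    & forall v, v \in levi_simple -> D v w = 0].
Proof.
move=> Wsub Wt WD Wp p0.
have [q Wq qE] := weight_component (wt (mlead p)) Wsub Wt Wp.
have q0 : q != 0.
  apply: contraNneq p0 => q0; rewrite -mleadc_eq0.
  by have := qE (mlead p); rewrite q0 mcoeff0 eqxx => <-.
have qw : has_weight (wt (mlead p)) q.
  by move=> m; rewrite mcoeff_msupp qE; have [->|_] := eqVneq (wt m); rewrite ?eqxx.
have : exists N, {in msupp q, forall m, (depth m < N)%N}.
  exists (\sum_(m <- msupp q) (depth m).+1)%N => m mq.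
  by rewrite (big_rem m) //= leq_addr.
move: (wt _) qw => mu qw [N]; elim: N q mu q0 Wq qw {qE} => [|N IH] q mu q0 Wq qw qN.
  by have := qN _ (mlead_supp q0).
have [|] := boolP (all (fun v => D v q == 0) levi_simple).
  by move=> /allP Dq; exists q, mu; split=> // v /Dq/eqP.
rewrite -has_predC => /hasP[v vs /= Dvq].
apply: (IH (D v q) (mu + vec_weight v)) => //; first exact: WD.
  exact: has_weight_D.
move=> m /msupp_D[b [e [n [/(simple_raises vs) be /qN + ->]]]].
rewrite ltnS !depthD !depthU; apply: leq_trans.
by rewrite ltn_add2l ltn_sub2l // (leq_ltn_trans (ltnW be)).
Qed.

Inductive descendant (v : sym) : sym -> Prop :=
| descendant_self : descendant v v
| descendant_lower a p : a \in levi_simple_neg -> descendant v p ->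
    descendant v (D a p).

(** This is U(n^-) v for the sum n^- of the negative Levi root spaces; words in the simple lowering
    operators suffice. For a highest weight vector it is stable under all of [P7]. *)
Definition generated (v : sym) : sym -> Prop := span_of (descendant v).

Lemma generated_subspace v : subspace (generated v).
Proof. exact: span_of_subspace. Qed.

Lemma generated_self v : generated v v.
Proof. by apply/span_of_mem/descendant_self. Qed.

Lemma generated_min v (W : sym -> Prop) : subspace W ->
  (forall a, a \in levi_simple_neg -> forall p, W p -> W (D a p)) -> W v ->
  forall p, generated v p -> W p.
Proof.
move=> Wsub WD Wv; apply: span_of_min => // p; elim=> // a q ai _.
exact: WD.
Qed.

Lemma generated_linear v (f : {linear sym -> sym}) :
  (forall p, descendant v p -> generated v (f p)) ->
  forall p, generated v p -> generated v (f p).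
Proof.
move=> vf; apply: span_of_min vf.
exact: (subspace_preim f (generated_subspace v)).
Qed.

Lemma descendant_weight v mu p : has_weight mu v -> descendant v p ->
  exists nu, has_weight nu p.
Proof.
move=> vm; elim=> [|a q _ _ [nu qn]]; first by exists mu.
by exists (nu + vec_weight a); apply: has_weight_D.
Qed.

Lemma descendant_homog v d p : v \is d.-homog -> descendant v p -> p \is d.-homog.
Proof. by move=> vd; elim=> // a q _ _; apply: dhomog_D. Qed.

Lemma generated_homog v d p : v \is d.-homog -> generated v p -> p \is d.-homog.
Proof.
move=> vd; move: p; apply: (@span_of_min _ _ _ (fun p => p \is d.-homog)) => [|q];
  last exact: descendant_homog.
by split=> [|c q r qd rd]; [exact: rpred0 | apply: rpredD => //; apply: rpredZ].
Qed.

Lemma generated_torus v mu t p : has_weight mu v -> (forall i, t i != 0) ->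
  generated v p -> generated v (sym_act (torus t) p).
Proof.
move=> vm t0; pose f : {linear sym -> sym} := sym_act (torus t).
move: p; apply: (@generated_linear v f) => q vq; rewrite /f /=.
have [nu /has_weightP -> //] := descendant_weight vm vq.
by apply/(subspaceZ (generated_subspace v))/span_of_mem.
Qed.

Lemma generated_neg v a p : a \in levi_neg -> generated v p -> generated v (D a p).
Proof.
have vs := generated_subspace v.
move=> al; move: a al p.
apply: (@commutator_levels_ind F _ _ _ levi_neg_levels) => [i si p vp|a a' i c IH1 IH2 aE p vp].
  move: p vp; apply: (@generated_linear v (D i)) => q vq.
  by apply: span_of_mem; apply: descendant_lower.
by rewrite aE; apply/(subspaceZ vs)/(subspaceB vs); auto.
Qed.

(** A simple raising operator is moved through a word of lowering operators: each commutator is a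
    scalar on the weight vector it meets, and v itself is killed. The other positive roots follow by
    commutators. *)
Lemma generated_pos v mu a p : has_weight mu v ->
  (forall i, i \in levi_simple -> D i v = 0) ->
  a \in levi_pos -> generated v p -> generated v (D a p).
Proof.
have vs := generated_subspace v.
move=> vm Dv al; move: a al p.
apply: (@commutator_levels_ind F _ _ _ levi_pos_levels) => [i si|a a' i c IH1 IH2 aE p vp].
  apply: (@generated_linear v (D i)) => q; elim=> [|b r bs vr IH].
    by rewrite /= Dv //; apply: span_of0.
  have [nu rn] := descendant_weight vm vr.
  have [c cE] := simple_commutator si bs rn.
  rewrite /= -[D i _](subrK (D b (D i r))) cE.
  apply: (subspaceD vs); first by apply/(subspaceZ vs)/span_of_mem.
  apply: generated_neg => //.
  move: bs => /mapP[b' /levi_simple_pos b'l ->].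
  by rewrite map_f.
by rewrite aE; apply/(subspaceZ vs)/(subspaceB vs); auto.
Qed.

Lemma generated_P7 v mu s p : has_weight mu v ->
  (forall i, i \in levi_simple -> D i v = 0) ->
  P7 s -> generated v p -> generated v (sym_act s p).
Proof.
move=> vm Dv Ps; move: s Ps p; apply: P7_closed => [t t0 p|a c a0 p].
  exact: generated_torus vm t0.
apply: (closed_D_exp (generated_subspace v) a0) => q vq.
have := levi_root_in a0; rewrite mem_cat => /orP[] al.
  exact: generated_pos vm Dv al vq.
exact: generated_neg.
Qed.

End HighestWeights.

(** * The three basic invariants *)

(* lambda6 and 2 lambda7 in the basis of simple roots. *)
Definition vec_lambda6 : seq int := [:: 2; 3; 4; 6; 5; 4; 2].
Definition vec_2lambda7 : seq int := [:: 2; 3; 4; 6; 5; 4; 3].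

(** Since lambda6 has squared length 4, tangent roots with sum lambda6 are orthogonal and the sign
    is symmetric in u and v. There are five such pairs, so [h2] is a quadric in ten variables. *)
Definition coef2 (u v : seq int) : int :=
  if vadd u v == vec_lambda6 then epsz u v else 0.

(* epsz is bimultiplicative and epsz u v * epsz v u = (-1) ^ (u, v); with these
   signs the two monomials that D a sends to the same monomial cancel. *)
Definition coef3 (u v w : seq int) : int :=
  if vadd (vadd u v) w == vec_2lambda7 then epsz u v * epsz u w * epsz v w else 0.

(* The coefficient at X_e of the image of \sum_b f(b) X_b under D a. *)
Definition lower (a e : seq int) (f : seq int -> int) : int :=
  let v := vadd e (vneg a) in if v \in tvecs then f v * epsz a v else 0.

Lemma coef2_invariant a e c : a \in levi_simple -> e \in tvecs -> c \in tvecs ->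
  lower a e (coef2^~ c) + lower a c (coef2 e) = 0.
Proof.
move=> al et ct; apply/eqP.
have /allP/(_ a al)/allP/(_ e et)/allP/(_ c ct) // : all (fun a => all (fun e =>
  all (fun c => lower a e (coef2^~ c) + lower a c (coef2 e) == 0)
  tvecs) tvecs) levi_simple.
by vm_compute.
Qed.

Lemma lower_eq0 a e f : (forall v, vadd a v = e -> f v = 0) -> size e = 7 ->
  lower a e f = 0.
Proof.
by move=> f0 se; rewrite /lower; case: ifP => // _; rewrite f0 ?mul0r // vaddNK.
Qed.

(** All terms vanish unless e + c + d = a + 2 lambda7. Then d is determined by e and c, so 27^2
    cases per simple root are computed instead of 27^3. *)
Lemma coef3_invariant a e c d : a \in levi_simple ->
  e \in tvecs -> c \in tvecs -> d \in tvecs ->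
  lower a e (fun v => coef3 v c d) + lower a c (fun v => coef3 e v d) +
  lower a d (coef3 e c) = 0.
Proof.
move=> al et ct dt.
have [se sc sd] := And3 (size_tvecs et) (size_tvecs ct) (size_tvecs dt).
have [s3|s3] := eqVneq (vadd (vadd e c) d) (vadd a vec_2lambda7).
  have {s3}: d = vadd (vadd a vec_2lambda7) (vneg (vadd e c)) by rewrite -s3 vaddKN.
  have /allP/(_ a al)/allP/(_ e et)/allP/(_ c ct) : all (fun a => all (fun e =>
    all (fun c => let d := vadd (vadd a vec_2lambda7) (vneg (vadd e c)) in
      (d \in tvecs) ==> (lower a e (fun v => coef3 v c d) +
        lower a c (fun v => coef3 e v d) + lower a d (coef3 e c) == 0))
    tvecs) tvecs) levi_simple by vm_compute.
  by move=> /= /implyP chk dE; apply/eqP; rewrite dE; apply: chk; rewrite -dE.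
rewrite !lower_eq0 ?addr0 // => v vE; rewrite /coef3; case: eqP => // s3';
  case/eqP: s3; rewrite -s3' -vE.
- by rewrite !vaddA [vadd (vadd e c) a]vaddC !vaddA.
- by rewrite !vaddA [vadd e a]vaddC.
- by rewrite !vaddA.
Qed.

Section Invariants.

Variable F : numClosedFieldType.
Local Notation sym := (sym F).
Local Notation D := (@root_deriv F).

Definition h1 : sym := 'X_(ord_max : 'I_27).

Definition h2 : sym :=
  \sum_(b < 27) \sum_(c < 27) (coef2 (tv b) (tv c))%:~R *: ('X_b * 'X_c).

Definition h3 : sym := \sum_(b < 27) \sum_(c < 27) \sum_(d < 27)
  (coef3 (tv b) (tv c) (tv d))%:~R *: ('X_b * ('X_c * 'X_d)).

Lemma sum_lower a f q :
  \sum_(b < 27) (f (tv b))%:~R *: (D a 'X_b * q) =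
  \sum_(e < 27) (lower a (tv e) f)%:~R *: ('X_e * q).
Proof.
under eq_bigr => b _ do rewrite DX /Xv -scalerAl mulr_suml !scaler_sumr.
rewrite (exchange_big_dep xpredT) //=; apply: eq_bigr => e _.
rewrite /lower; case: ifP => [/tvecsP[b be]|et].
  rewrite (big_pred1 b) => [|d /=]; first by rewrite be scalerA rmorphM.
  apply/eqP/eqP => [ed|->]; last by rewrite -be vaddNK // size_tvecs ?tv_in.
  by apply: tv_inj; rewrite -be ed vaddKN // size_tvecs ?tv_in.
rewrite scale0r big1 // => b /eqP ed.
by rewrite ed vaddKN ?tv_in ?size_tvecs ?tv_in in et.
Qed.

Lemma D_h1 a : a \in levi_simple -> D a h1 = 0.
Proof.
move=> al; rewrite DX Xv_out ?scaler0 //.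
by apply: (allP (_ : all (fun a => vadd a (tv 26) \notin tvecs) levi_simple)).
Qed.

Lemma D_h2 a : a \in levi_simple -> D a h2 = 0.
Proof.
move=> al; rewrite linear_sum.
under eq_bigr => b _ do (rewrite linear_sum;
  under eq_bigr => c _ do rewrite linearZ /= DM [X in _ + X]mulrC scalerDr;
  rewrite big_split sum_lower).
rewrite big_split exchange_big /=.
under eq_bigr => c _ do rewrite (sum_lower a (coef2^~ (tv c))).
rewrite exchange_big -big_split big1 // => b _ /=.
rewrite -big_split big1 // => c _ /=.
by rewrite [X in _ + _ *: X]mulrC -scalerDl -rmorphD coef2_invariant ?tv_in // scale0r.
Qed.

Lemma D_h3 a : a \in levi_simple -> D a h3 = 0.
Proof.
move=> al; have -> : D a h3 =
    \sum_(e < 27) \sum_(c < 27) \sum_(d < 27)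
      (lower a (tv e) (fun v => coef3 v (tv c) (tv d)) +
       lower a (tv c) (fun v => coef3 (tv e) v (tv d)) +
       lower a (tv d) (coef3 (tv e) (tv c)))%:~R *: ('X_e * ('X_c * 'X_d)).
  (* Leibniz, with the differentiated variable moved to the front, the shape that [sum_lower]
     expects. *)
  transitivity (\sum_(b < 27) \sum_(c < 27) \sum_(d < 27)
      ((coef3 (tv b) (tv c) (tv d))%:~R *: (D a 'X_b * ('X_c * 'X_d)) +
       (coef3 (tv b) (tv c) (tv d))%:~R *: (D a 'X_c * ('X_b * 'X_d)) +
       (coef3 (tv b) (tv c) (tv d))%:~R *: (D a 'X_d * ('X_b * 'X_c)))).
    rewrite linear_sum; apply: eq_bigr => b _; rewrite linear_sum.
    apply: eq_bigr => c _; rewrite linear_sum; apply: eq_bigr => d _.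
    rewrite linearZ /= !DM -!scalerDr; congr (_ *: _); ring.
  under eq_bigr => b _ do
    (under eq_bigr => c _ do rewrite !big_split /=; rewrite !big_split /=).
  rewrite !big_split /=.
  under [RHS]eq_bigr => b _ do (under eq_bigr => c _ do
    (under eq_bigr => d _ do rewrite !rmorphD !scalerDl /=; rewrite !big_split /=);
    rewrite !big_split /=).
  rewrite !big_split /=; congr (_ + _ + _).
  - rewrite exchange_big [RHS]exchange_big; apply: eq_bigr => c _.
    rewrite exchange_big [RHS]exchange_big; apply: eq_bigr => d _.
    exact: (sum_lower a (fun v => coef3 v (tv c) (tv d))).
  - apply: eq_bigr => b _.
    rewrite exchange_big [RHS]exchange_big; apply: eq_bigr => d _.
    rewrite (sum_lower a (fun v => coef3 (tv b) v (tv d))).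
    by apply: eq_bigr => c _; congr (_ *: _); ring.
  - apply: eq_bigr => b _; apply: eq_bigr => c _.
    rewrite (sum_lower a (coef3 (tv b) (tv c))).
    by apply: eq_bigr => d _; congr (_ *: _); ring.
apply: big1 => b _; apply: big1 => c _; apply: big1 => d _.
by rewrite coef3_invariant ?tv_in // scale0r.
Qed.

Lemma has_weight_subspace mu : subspace (@has_weight F mu).
Proof.
split=> [m|c p q pm qm m]; first by rewrite msupp0.
by move=> /msuppD_le; rewrite mem_cat => /orP[/msuppZ_le/pm|/qm].
Qed.

Lemma has_weight_var (b : 'I_27) : has_weight (vec_weight (tv b)) ('X_b : sym).
Proof. by move=> m; rewrite msuppX inE => /eqP ->; exact: wtU. Qed.

Lemma vec_weight_delta v (j : 'I_7) :
  all (fun i => pairing v i == (i == j :> nat)%:R) (iota 0 7) ->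
  vec_weight v = delta_mx 0 j.
Proof.
move=> /allP vj; apply/rowP => i; rewrite !mxE eqxx /=; apply/eqP.
by apply: vj; rewrite mem_iota ltn_ord.
Qed.

Lemma has_weight_h1 : has_weight lambda1 h1.
Proof.
have -> : lambda1 = vec_weight (tv 26).
  by rewrite (@vec_weight_delta _ (inord 0)) // inordK; vm_compute.
exact: has_weight_var.
Qed.

Lemma has_weight_h2 : has_weight lambda6 h2.
Proof.
have l6E : lambda6 = vec_weight vec_lambda6.
  by rewrite (@vec_weight_delta _ (inord 5)) // inordK; vm_compute.
apply: (subspace_sum (has_weight_subspace _)) => b _.
apply: (subspace_sum (has_weight_subspace _)) => c _.
rewrite /coef2; case: eqP => [bc|_]; last by rewrite scale0r; exact: (has_weight_subspace _).1.
apply: has_weightZ; rewrite l6E -bc vec_weightD.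
by apply: has_weightM; apply: has_weight_var.
Qed.

Lemma has_weight_h3 : has_weight (lambda7 *+ 2) h3.
Proof.
have l7E : lambda7 *+ 2 = vec_weight vec_2lambda7.
  apply/rowP => i; rewrite mulmxnE !mxE eqxx /= -[_ *+ 2]mulr_natl; apply/esym/eqP.
  have /allP : all (fun i => pairing vec_2lambda7 i == 2%:R * (i == 6 :> nat)%:R)
    (iota 0 7) by vm_compute.
  move=> /(_ i); rewrite mem_iota ltn_ord => /(_ isT).
  by rewrite -[i == inord 6](inj_eq val_inj) /= inordK.
apply: (subspace_sum (has_weight_subspace _)) => b _.
apply: (subspace_sum (has_weight_subspace _)) => c _.
apply: (subspace_sum (has_weight_subspace _)) => d _.
rewrite /coef3; case: eqP => [bc|_]; last by rewrite scale0r; exact: (has_weight_subspace _).1.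
apply: has_weightZ; rewrite l7E -bc !vec_weightD -addrA.
by do 2 (apply: has_weightM; first exact: has_weight_var); apply: has_weight_var.
Qed.

Lemma dhomog_var (b : 'I_27) : ('X_b : sym) \is 1.-homog.
Proof. by rewrite dhomogX /= mdeg1. Qed.

Lemma h1_homog : h1 \is 1.-homog.
Proof. exact: dhomog_var. Qed.

Lemma h2_homog : h2 \is 2.-homog.
Proof.
apply: rpred_sum => b _; apply: rpred_sum => c _; apply: rpredZ.
exact: (dhomogM (dhomog_var b) (dhomog_var c)).
Qed.

Lemma h3_homog : h3 \is 3.-homog.
Proof.
apply: rpred_sum => b _; apply: rpred_sum => c _; apply: rpred_sum => d _; apply: rpredZ.
exact: (dhomogM (dhomog_var b) (dhomogM (dhomog_var c) (dhomog_var d))).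
Qed.

End Invariants.

(** * Values of the invariants at points with coordinates 0 and 1 *)

Section Points.

Variable F : numClosedFieldType.
Local Notation sym := (sym F).
Local Notation D := (@root_deriv F).
Local Notation h1 := (h1 F).
Local Notation h2 := (h2 F).
Local Notation h3 := (h3 F).
Implicit Types (x y : 'I_27 -> F) (s : seq nat).

Definition indicator s : 'I_27 -> F := fun b => (val b \in s)%:R.

Lemma sum_indicator (G : nat -> int) s : uniq s -> all (fun b => (b < 27)%N) s ->
  \sum_(b < 27) (G b)%:~R * indicator s b = (\sum_(b <- s) G b)%:~R.
Proof.
move=> us /allP s27.
rewrite rmorph_sum -(big_mkord xpredT (fun b => (G b)%:~R * (b \in s)%:R)).
rewrite (eq_bigr (fun b => if b \in s then (G b)%:~R else 0)); last first.
  by move=> b _; case: (b \in s); rewrite ?mulr1 ?mulr0.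
rewrite -big_mkcond -big_filter; apply: perm_big; apply: uniq_perm => //.
  by rewrite filter_uniq // iota_uniq.
move=> b; rewrite mem_filter mem_index_iota /=.
by case: (boolP (b \in s)) => // /s27.
Qed.

Lemma h1_eval x : h1.@[x] = x ord_max.
Proof. exact: mevalXU. Qed.

Lemma h2_eval x :
  h2.@[x] = \sum_(b < 27) \sum_(c < 27) (coef2 (tv b) (tv c))%:~R * (x b * x c).
Proof.
rewrite /h2 linear_sum; apply: eq_bigr => b _; rewrite linear_sum; apply: eq_bigr => c _.
by rewrite /= mevalZ mevalM !mevalXU.
Qed.

Lemma h3_eval x : h3.@[x] = \sum_(b < 27) \sum_(c < 27) \sum_(d < 27)
   (coef3 (tv b) (tv c) (tv d))%:~R * (x b * (x c * x d)).
Proof.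
rewrite /h3 linear_sum; apply: eq_bigr => b _; rewrite linear_sum; apply: eq_bigr => c _.
by rewrite linear_sum; apply: eq_bigr => d _; rewrite /= mevalZ !mevalM !mevalXU.
Qed.

Lemma h2_indicator s : uniq s -> all (fun b => (b < 27)%N) s ->
  h2.@[indicator s] = (\sum_(b <- s) \sum_(c <- s) coef2 (tv b) (tv c))%:~R.
Proof.
move=> us s27; rewrite h2_eval -sum_indicator //; apply: eq_bigr => b _.
rewrite -sum_indicator // mulr_suml; apply: eq_bigr => c _.
by rewrite -mulrA [_ b * _]mulrC.
Qed.

Lemma h3_indicator s : uniq s -> all (fun b => (b < 27)%N) s ->
  h3.@[indicator s] =
  (\sum_(b <- s) \sum_(c <- s) \sum_(d <- s) coef3 (tv b) (tv c) (tv d))%:~R.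
Proof.
move=> us s27; rewrite h3_eval -sum_indicator //; apply: eq_bigr => b _.
rewrite -sum_indicator // mulr_suml; apply: eq_bigr => c _.
rewrite -sum_indicator // !mulr_suml; apply: eq_bigr => d _.
by ring.
Qed.

(* The strongly orthogonal tangent roots lambda1, lambda6 - lambda1 and
   2 lambda7 - lambda6. *)
Definition base_support : seq nat := [:: 26; 14; 0].
Definition base_point := indicator base_support.

Lemma h1_base : h1.@[base_point] = 1.
Proof. by rewrite h1_eval. Qed.

Lemma h2_base : h2.@[base_point] != 0.
Proof.
rewrite h2_indicator // intr_eq0 !big_cons !big_nil; by vm_compute.
Qed.

Lemma h3_base : h3.@[base_point] != 0.
Proof.
rewrite h3_indicator // intr_eq0 !big_cons !big_nil; by vm_compute.
Qed.

Lemma h1_zero_point : exists x, [/\ h1.@[x] = 0, h2.@[x] != 0 & h3.@[x] != 0].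
Proof.
(* Another pair with sum lambda6, avoiding the highest root, completed by alpha_7 to a triple with
   sum 2 lambda7. *)
exists (indicator [:: 25; 16; 0]).
rewrite h1_eval h2_indicator // h3_indicator // !intr_eq0 !big_cons !big_nil.
by split=> //; vm_compute.
Qed.

Lemma h2_zero_point : exists x, [/\ h1.@[x] != 0, h2.@[x] = 0 & h3.@[x] != 0].
Proof.
(* A triple with sum 2 lambda7, no two members of which have sum lambda6. *)
exists (indicator [:: 26; 11; 1]).
rewrite h1_eval h2_indicator // h3_indicator // intr_eq0 !big_cons !big_nil.
split; [exact: oner_neq0 | | by vm_compute].
by apply/eqP; rewrite intr_eq0; vm_compute.
Qed.

Lemma h3_zero_point : exists x, [/\ h1.@[x] != 0, h2.@[x] != 0 & h3.@[x] = 0].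
Proof.
exists (indicator [:: 26; 14]).
rewrite h1_eval h2_indicator // h3_indicator // intr_eq0 !big_cons !big_nil.
split; [exact: oner_neq0 | by vm_compute |].
by apply/eqP; rewrite intr_eq0; vm_compute.
Qed.

End Points.

(** * Reduction of a generic point *)

Section Vanishing.

Variables (F : numFieldType) (n : nat).

Lemma poly_fun_eq0 (q : {poly F}) : (forall z, q.[z] = 0) -> q = 0.
Proof.
move=> q0; apply/eqP/negPn/negP => /max_poly_roots.
move=> /(_ [seq k%:R | k <- iota 0 (size q)]).
rewrite size_map size_iota ltnn => H; apply: notF; apply: H.
  by apply/allP => z _; apply/rootP.
by rewrite map_inj_uniq ?iota_uniq //; exact: mulrIn (oner_neq0 _).
Qed.

(** Freeing the i-th coordinate turns p into a univariate polynomial with every value zero, hence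
    zero; by the chain rule its derivative is the restriction of the partial derivative. *)
Lemma meval_mderiv_eq0 i (p : {mpoly F[n]}) :
  (forall x, p.@[x] = 0) -> forall x, (p^`M(i)).@[x] = 0.
Proof.
move=> p0 x; pose h j : {poly F} := if j == i then 'X else (x j)%:P.
pose phi := mmap (@polyC F) h.
have horner_phi q z : (phi q).[z] = q.@[fun j => if j == i then z else x j].
  rewrite /phi /mmap mevalE horner_sum; apply: eq_bigr => m _.
  rewrite hornerCM; congr (_ * _); rewrite /mmap1 horner_prod; apply: eq_bigr => j _.
  by rewrite horner_exp /h; case: eqP => _; rewrite ?hornerX ?hornerC.
have chain q : (phi q)^`() - phi (q^`M(i)) = 0.
  apply: (@derivation_eq0 _ _ _ phi (fun q => (phi q)^`() - phi (q^`M(i)))) => [c r s|r s||j].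
  - rewrite /phi !linearP /= !mmapD !mmapZ !derivD !derivM !derivC /= -!mul_polyC.
    by ring.
  - by rewrite mderivM /phi !rmorphM !rmorphD !rmorphM /= derivM; ring.
  - exact: rmorph1.
  rewrite /phi mderivX mmapZ !mmapX !mmap1U mnm1E /h.
  case: eqP => [->|_]; last by rewrite derivC mul0r subrr.
  have -> : (U_(i) - U_(i) = 0 :> 'X_{1..n})%MM by rewrite -{1}[U_(i)%MM]add0m addmK.
  by rewrite mmap11 derivX mulr1 subrr.
have phi0 : phi p = 0 by apply: poly_fun_eq0 => z; rewrite horner_phi.
have := chain p; rewrite phi0 linear0 sub0r => /eqP; rewrite oppr_eq0 => /eqP d0.
have := horner_phi (p^`M(i)) (x i); rewrite d0 horner0 => ->.
by apply: meval_eq => j; case: eqP => [->|].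
Qed.

(** By induction on the degree all partial derivatives are zero; in characteristic 0 this leaves a
    constant. *)
Lemma meval_eq0 (p : {mpoly F[n]}) : (forall x, p.@[x] = 0) -> p = 0.
Proof.
have [k] := ubnP (msize p); elim: k p => // k IH p; rewrite ltnS => pk p0.
have dp0 i m : p@_(m + U_(i)) = 0.
  have : p^`M(i) = 0.
    have [->|d0] := eqVneq (p^`M(i)) 0; first by [].
    apply: IH; last exact: meval_mderiv_eq0.
    apply: leq_trans pk; rewrite -mlead_deg //.
    have := mlead_supp d0; rewrite mcoeff_msupp mcoeff_deriv => dm.
    have : (mlead p^`M(i) + U_(i))%MM \in msupp p.
      by rewrite mcoeff_msupp; apply: contraNneq dm => ->; rewrite mul0rn.
    by move/msize_mdeg_lt; rewrite mdegD mdeg1 addn1.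
  move/(congr1 (mcoeff m)); rewrite mcoeff_deriv mcoeff0 => /eqP.
  by rewrite mulrn_eq0 => /eqP.
have pC : p = (p@_0)%:MP.
  apply/mpolyP => m; rewrite mcoeffC.
  have [->|m0] := eqVneq m 0%MM; first by rewrite mulr1.
  rewrite mulr0; have [i mi] : exists i, m i != 0%N.
    apply/existsP; apply: contraNT m0 => /existsPn m0.
    by apply/eqP/mnmP => i; rewrite mnm0E; apply/eqP; rewrite -[_ == _]negbK m0.
  by have := dp0 i (m - U_(i))%MM; rewrite submK // lep1mP.
by move: (p0 (fun=> 0)); rewrite pC mevalC => ->.
Qed.

End Vanishing.

(* The coordinates in Z already vanish; subtracting a multiple of the coordinate
   p kills the coordinates in ks one by one without disturbing p or Z. *)
Fixpoint elim_check (p : nat) (Z ks : seq nat) : bool :=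
  if ks is b :: ks' then
    let a := vadd (tv p) (vneg (tv b)) in
    [&& (b < 27)%N, b != p, a \in levi_pos, vadd a (tv b) == tv p,
        all (fun b' => all (fun e =>
          (vadd a (tv b') == tv e) ==> ((b' != p) && (e \in Z))) (iota 0 27)) (p :: Z)
      & elim_check p (b :: Z) ks']
  else true.

(* The tangent roots b such that tv 26 - tv b is a Levi root; below, the remaining
   ones such that tv 14 - tv b is. *)
Definition pivot1_targets : seq nat :=
  [:: 6; 8; 10; 12; 13; 15; 16; 17; 18; 19; 20; 21; 22; 23; 24; 25].

Definition pivot2_targets : seq nat := [:: 1; 2; 3; 4; 5; 7; 9; 11].

Lemma elim_check1 : elim_check 26 [::] pivot1_targets.
Proof. by vm_compute. Qed.

Lemma elim_check2 : elim_check 14 pivot1_targets pivot2_targets.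
Proof. by vm_compute. Qed.

Section Elimination.

Variable F : numClosedFieldType.
Local Notation sym := (sym F).
Local Notation D := (@root_deriv F).
Local Notation h1 := (h1 F).
Local Notation h2 := (h2 F).
Local Notation h3 := (h3 F).
Local Notation base_point := (@base_point F).
Implicit Types (x y : 'I_27 -> F) (f : sym).

Definition levi_fixed f : Prop := forall a c,
  positive_root a -> coef a 6 = 0 -> sym_act (exp_ad a c) f = f.

Lemma killed_levi_fixed f : (forall a, a \in levi_simple -> D a f = 0) -> levi_fixed f.
Proof.
move=> Df a c ap a0; apply: sym_act_exp_fixed => //.
exact: (killed_by_levi_pos Df) (positive_levi_root ap a0).
Qed.

Lemma h1_fixed : levi_fixed h1. Proof. exact/killed_levi_fixed/D_h1. Qed.
Lemma h2_fixed : levi_fixed h2. Proof. exact/killed_levi_fixed/D_h2. Qed.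
Lemma h3_fixed : levi_fixed h3. Proof. exact/killed_levi_fixed/D_h3. Qed.

(** The transpose of the action on linear forms: the value of f at the moved point is the value of
    exp(c D a) f at x. *)
Definition move_point (a : seq int) (c : F) x : 'I_27 -> F :=
  fun b => x b + c * (epsz a (tv b))%:~R * (Xv F (vadd a (tv b))).@[x].

Lemma move_point_fixed a c x f : a \in levi_pos -> levi_fixed f ->
  f.@[move_point a c x] = f.@[x].
Proof.
move=> /levi_pos_exists[r [<- rp r0]] ff.
rewrite -[in RHS](ff r c rp r0) /sym_act comp_mpoly_meval; apply: meval_eq => b.
by rewrite tnth_mktuple -sym_actXU sym_act_expX // DX mevalD !mevalZ mevalXU mulrA.
Qed.

Lemma eliminate (p : 'I_27) Z ks x : elim_check p Z ks -> x p != 0 ->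
  (forall b : 'I_27, val b \in Z -> x b = 0) ->
  exists y, [/\ forall f, levi_fixed f -> f.@[y] = f.@[x],
    y p = x p & forall b : 'I_27, val b \in ks ++ Z -> y b = 0].
Proof.
elim: ks Z x => [|b ks IH] Z x; first by move=> _ xp xZ; exists x.
cbn beta iota zeta delta [elim_check].
move=> /and5P[b27 bp al /eqP abp /andP[/andP[pchk Zchk] chk]] xp xZ.
set a := vadd _ _ in al abp pchk Zchk.
have Xe v : (forall e : 'I_27, v = tv e -> x e = 0) -> (Xv F v).@[x] = 0.
  move=> v0; have [/tvecsP[d vd]|/Xv_out ->] := boolP (v \in tvecs).
    by rewrite vd Xv_tv mevalXU v0.
  exact: meval0.
pose o := Ordinal b27.
(* As a + tv b = tv p, the coordinate b moves by c epsz(a, b) x_p; this choice of c cancels it. *)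
pose y := move_point a (- x o / ((epsz a (tv b))%:~R * x p)) x.
have s0 : (epsz a (tv b))%:~R != 0 :> F.
  by rewrite intr_eq0 /epsz; case: ifP.
have yp : y p = x p.
  rewrite /y /move_point Xe ?mulr0 ?addr0 // => e pe.
  by have /allP/(_ e) := pchk; rewrite mem_iota pe !eqxx /= => /(_ (ltn_ord e)).
have yo : y o = 0.
  rewrite /y /move_point abp Xv_tv mevalXU; field.
  by rewrite xp s0.
have yZ (d : 'I_27) : val d \in Z -> y d = 0.
  move=> dZ; rewrite /y /move_point xZ // Xe ?mulr0 ?addr0 // => e de.
  have /allP/(_ _ dZ)/allP/(_ e) := Zchk; rewrite mem_iota de eqxx /=.
  by move=> /(_ (ltn_ord e))/andP[_ /xZ].
have [||z [zf zp z0]] := IH (b :: Z) y chk; rewrite ?yp //.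
  by move=> d; rewrite inE => /orP[/eqP db|/yZ //]; rewrite -yo; congr y; apply: val_inj.
exists z; split=> [f ff||d]; first by rewrite zf // move_point_fixed.
  by rewrite zp.
move=> dk; apply: z0; rewrite mem_cat inE orbCA; move: dk.
by rewrite inE mem_cat.
Qed.

Definition torus3 (u v w : F) : 'I_7 -> F :=
  fun i => match val i with 0 => u | 5 => v | 6 => w | _ => 1 end.

Lemma torus3_neq0 u v w : u != 0 -> v != 0 -> w != 0 -> forall i, torus3 u v w i != 0.
Proof.
by move=> u0 v0 w0 [] [|[|[|[|[|[|[|]]]]]]] //= *; rewrite /torus3 /= ?oner_neq0.
Qed.

Lemma character_torus3 u v w (mu : weight) :
  character mu (torus3 u v w) =
  u ^ mu 0 (inord 0) * v ^ mu 0 (inord 5) * w ^ mu 0 (inord 6).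
Proof.
rewrite /character !big_ord_recl big_ord0 mulr1.
have muE (i : 'I_7) k : val i = k -> mu 0 i = mu 0 (inord k).
  by move=> <-; rewrite inord_val.
rewrite /torus3 /= !exp1rz !mul1r mulrA.
by congr (_ ^ _ * _ ^ _ * _ ^ _); apply: muE.
Qed.

Lemma torus_eval t mu f x : (forall i, t i != 0) -> has_weight mu f ->
  f.@[fun b => character (vec_weight (tv b)) t * x b] = character mu t * f.@[x].
Proof.
move=> t0 /has_weightP/(_ t t0) ft; rewrite -mevalZ -ft /sym_act comp_mpoly_meval.
apply: meval_eq => b; rewrite tnth_mktuple -sym_actXU sym_act_torusX mevalZ mevalXU.
by congr (character _ _ * _); apply/rowP => i; rewrite !mxE val_tangent_root.
Qed.

(** The elimination leads to a point z supported on the indices 26, 14, 0. On the three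
    corresponding roots [torus3 u v w] takes the values u, v / u and w^2 / v, so u = z_26, v = z_26
    z_14 and w is a square root of v z_0. The triple depends on x alone, not on f. *)
Lemma generic_point x : h1.@[x] != 0 -> h2.@[x] != 0 -> h3.@[x] != 0 ->
  exists u v w, [/\ u != 0, v != 0, w != 0 &
    forall f mu, levi_fixed f -> has_weight mu f ->
    f.@[x] = u ^ mu 0 (inord 0) * v ^ mu 0 (inord 5) * w ^ mu 0 (inord 6) * f.@[base_point]].
Proof.
move=> x1 x2 x3.
have [||y [yf yp y0]] := @eliminate ord_max [::] pivot1_targets x elim_check1 => //.
  by rewrite -h1_eval.
(* Of the pairs with sum lambda6 only (26, 14) avoids the eliminated coordinates, so a zero at 14
   would make [h2] vanish. *)
have y14 : y (inord 14) != 0.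
  apply: contraNneq x2 => y14; rewrite -yf; last exact: h2_fixed.
  have yz (b : 'I_27) : val b \in 14%N :: pivot1_targets -> y b = 0.
    rewrite inE => /orP[/eqP b14|bk]; last by rewrite y0 // cats0.
    by rewrite -y14; congr y; apply: val_inj; rewrite /= inordK.
  rewrite h2_eval big1 // => b _; rewrite big1 // => c _.
  have : [|| coef2 (tv b) (tv c) == 0, val b \in 14%N :: pivot1_targets
           | val c \in 14%N :: pivot1_targets].
    have /allP/(_ b) : all (fun b => all (fun c =>
      [|| coef2 (tv b) (tv c) == 0, b \in 14%N :: pivot1_targets
        | c \in 14%N :: pivot1_targets]) (iota 0 27)) (iota 0 27) by vm_compute.
    rewrite mem_iota => /(_ (ltn_ord b))/allP/(_ c); rewrite mem_iota; apply; exact: ltn_ord.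
  by case/or3P=> [/eqP -> | /yz -> | /yz ->]; rewrite ?mul0r ?mulr0.
have [||b bk|z [zf zp z0]] := @eliminate (inord 14) pivot1_targets pivot2_targets y.
- by rewrite inordK // elim_check2.
- exact: y14.
- by rewrite y0 // cats0.
have z26 : z ord_max = x ord_max.
  by rewrite -!h1_eval zf; [rewrite yf //|]; exact: h1_fixed.
have zs (b : 'I_27) : val b \notin base_support -> z b = 0.
  move=> bs; apply: z0.
  have /allP/(_ b) : all (fun b => (b \notin base_support) ==>
    (b \in pivot2_targets ++ pivot1_targets)) (iota 0 27) by [].
  by rewrite mem_iota bs; apply; exact: ltn_ord.
(* No monomial of [h3] involves only the indices 26 and 14. *)
have z00 : z ord0 != 0.
  apply: contraNneq x3 => z00; rewrite -yf; last exact: h3_fixed.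
  rewrite -zf; last exact: h3_fixed.
  have zz (b : 'I_27) : val b \notin [:: 26; 14]%N -> z b = 0.
    move=> bs; have [b0|b0] := eqVneq (val b) 0%N.
      by rewrite -z00; congr z; apply: val_inj.
    by apply: zs; rewrite !inE; move: bs b0; rewrite !inE !negb_or => /andP[-> ->] ->.
  rewrite h3_eval big1 // => b _; rewrite big1 // => c _; rewrite big1 // => d _.
  have [bs|/zz ->] := boolP (val b \in [:: 26; 14]%N); last by rewrite mul0r mulr0.
  have [cs|/zz ->] := boolP (val c \in [:: 26; 14]%N); last by rewrite mul0r !mulr0.
  have [ds|/zz ->] := boolP (val d \in [:: 26; 14]%N); last by rewrite !mulr0.
  have /allP/(_ _ bs)/allP/(_ _ cs)/allP/(_ _ ds)/eqP -> :
    all (fun b => all (fun c => all (fun d => coef3 (tv b) (tv c) (tv d) == 0)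
      [:: 26; 14]%N) [:: 26; 14]%N) [:: 26; 14]%N by vm_compute.
  by rewrite mul0r.
have u0 : z ord_max != 0 by rewrite z26 -h1_eval.
have z14 : z (inord 14) != 0 by rewrite zp.
pose v := z ord_max * z (inord 14).
have v0 : v != 0 by rewrite mulf_neq0.
have w20 : v * z ord0 != 0 by rewrite mulf_neq0.
pose w := sqrtC (v * z ord0).
have w0 : w != 0 by rewrite sqrtC_eq0.
exists (z ord_max), v, w; split=> // f mu ff fm.
rewrite -yf // -zf // -character_torus3.
have t0 := torus3_neq0 u0 v0 w0.
rewrite -(torus_eval base_point t0 fm); apply: meval_eq => b.
rewrite character_torus3 !mxE !inordK // /base_point /indicator.
have [bs|bs] := boolP (val b \in base_support); last by rewrite zs // mulr0.
rewrite mulr1.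
have tE (c : 'I_27) k i : val c = k -> pairing (tv c) i = pairing (tv k) i by move=> ->.
move: bs; rewrite !inE => /or3P[] /eqP bk; rewrite !(tE b _ _ bk).
- have -> : b = ord_max by apply: val_inj.
  have [-> [-> ->]] : pairing (tv 26) 0 = 1 /\
      pairing (tv 26) 5 = 0 /\ pairing (tv 26) 6 = 0 by vm_compute.
  by rewrite !expr0z !mulr1.
- have -> : b = inord 14 by apply: val_inj; rewrite /= inordK.
  have [-> [-> ->]] : pairing (tv 14) 0 = -1 /\
      pairing (tv 14) 5 = 1 /\ pairing (tv 14) 6 = 0 by vm_compute.
  by rewrite expr0z mulr1 expr1z exprN1 mulKf.
- have -> : b = ord0 by apply: val_inj.
  have [-> [-> ->]] : pairing (tv 0) 0 = 0 /\
      pairing (tv 0) 5 = -1 /\ pairing (tv 0) 6 = 2 by vm_compute.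
  by rewrite expr0z mul1r exprN1 -exprnP sqrtCK mulKf.
Qed.

End Elimination.

(** * Classification of the highest weight vectors *)

Section Classification.

Variable F : numClosedFieldType.
Local Notation sym := (sym F).
Local Notation D := (@root_deriv F).
Local Notation h1 := (h1 F).
Local Notation h2 := (h2 F).
Local Notation h3 := (h3 F).
Local Notation base_point := (@base_point F).
Implicit Types (x : 'I_27 -> F) (f p q : sym).

Lemma h1_neq0 : h1 != 0.
Proof. by apply: contra_eq_neq (@h1_base F) => ->; rewrite meval0 eq_sym oner_neq0. Qed.

Lemma h2_neq0 : h2 != 0.
Proof. by apply: contraNneq (@h2_base F) => ->; rewrite meval0. Qed.

Lemma h3_neq0 : h3 != 0.
Proof. by apply: contraNneq (@h3_base F) => ->; rewrite meval0. Qed.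

Definition hmon (i j k : nat) : sym := h1 ^+ i * h2 ^+ j * h3 ^+ k.

Lemma hmonE i j k : hmon i j k = h1 ^+ i * h2 ^+ j * h3 ^+ k.
Proof. by []. Qed.

Definition hweight (i j k : nat) : weight :=
  lambda1 *+ i + lambda6 *+ j + (lambda7 *+ 2) *+ k.

Lemma hmon_neq0 i j k : hmon i j k != 0.
Proof. by rewrite !mulf_neq0 // expf_neq0 // (h1_neq0, h2_neq0, h3_neq0). Qed.

Lemma hmon_weight i j k : has_weight (hweight i j k) (hmon i j k).
Proof.
apply: has_weightM; first apply: has_weightM; apply: has_weightX;
  [exact: has_weight_h1 | exact: has_weight_h2 | exact: has_weight_h3].
Qed.

Lemma hmon_homog i j k : hmon i j k \is (i + 2 * j + 3 * k).-homog.
Proof.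
have h1i := dhomogMn i (@h1_homog F); rewrite mul1n in h1i.
exact: dhomogM (dhomogM h1i (dhomogMn j (@h2_homog F))) (dhomogMn k (@h3_homog F)).
Qed.

Lemma D_expr a p n : D a p = 0 -> D a (p ^+ n) = 0.
Proof.
move=> Dp; elim: n => [|n IH]; last by rewrite exprS DM Dp IH mul0r mulr0 addr0.
by apply: (@addrI _ (D a 1)); rewrite expr0 addr0 -{3}[1]mulr1 DM mulr1 mul1r.
Qed.

Lemma D_hmon a i j k : a \in levi_simple -> D a (hmon i j k) = 0.
Proof.
by move=> al; rewrite !DM !D_expr ?D_h1 ?D_h2 ?D_h3 // !(mul0r, mulr0, addr0).
Qed.

Lemma delta_inord (j k : nat) : (j < 7)%N -> (k < 7)%N ->
  (delta_mx 0 (inord j) : weight) 0 (inord k) = (k == j)%:R.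
Proof. by move=> j7 k7; rewrite mxE eqxx -(inj_eq val_inj) /= !inordK. Qed.

Lemma hweightE i j k : [/\ hweight i j k 0 (inord 0) = i%:Z,
  hweight i j k 0 (inord 5) = j%:Z & hweight i j k 0 (inord 6) = (2 * k)%N%:Z].
Proof.
rewrite /hweight !mxE !mulmxnE !delta_inord //= !mul0rn !addr0 !add0r.
by rewrite -mulrnA !natz.
Qed.

Lemma hweight_inj i j k i' j' k' : hweight i j k = hweight i' j' k' ->
  [/\ i = i', j = j' & k = k'].
Proof.
move=> ww; have [E1 E2 E3] := hweightE i j k; have [E1' E2' E3'] := hweightE i' j' k'.
rewrite ww E1' in E1; rewrite ww E2' in E2; rewrite ww E3' in E3.
split; [by case: E1 | by case: E2 |].
by case: E3 => /eqP; rewrite eqn_mul2l => /eqP.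
Qed.

(** If f vanishes at the base point, it vanishes wherever h1 h2 h3 does not, so f h1 h2 h3 is zero
    everywhere. *)
Lemma base_point_neq0 f mu : levi_fixed f -> has_weight mu f -> f != 0 ->
  f.@[base_point] != 0.
Proof.
move=> ff fm; apply: contraNneq => f0.
have /eqP : f * (h1 * h2 * h3) = 0.
  apply: meval_eq0 => x; rewrite !mevalM.
  have [->|x1] := eqVneq h1.@[x] 0; first by rewrite !mul0r mulr0.
  have [->|x2] := eqVneq h2.@[x] 0; first by rewrite mulr0 mul0r mulr0.
  have [->|x3] := eqVneq h3.@[x] 0; first by rewrite !mulr0.
  have [u [v [w [_ _ _ gen]]]] := generic_point x1 x2 x3.
  rewrite (gen f mu) //.
  by rewrite f0 mulr0 mul0r.
by rewrite !mulf_eq0 (negPf h1_neq0) (negPf h2_neq0) (negPf h3_neq0) !orbF.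
Qed.

(** The torus element alpha_7^vee(-1) fixes the base point, where f is nonzero, so its character on
    mu is 1. *)
Lemma even_weight f mu : levi_fixed f -> has_weight mu f -> f != 0 ->
  exists k : int, mu 0 (inord 6) = k * 2.
Proof.
move=> ff fm f0.
have t0 : forall i, torus3 1 1 (-1 : F) i != 0.
  by apply: torus3_neq0; rewrite ?oppr_eq0 oner_neq0.
have := torus_eval base_point t0 fm; rewrite character_torus3 !exp1rz !mul1r.
rewrite (@meval_eq _ _ _ base_point) => [/eqP|b]; last first.
  rewrite /base_point /indicator.
  have [bs|_] := boolP (val b \in base_support); last by rewrite mulr0.
  rewrite mulr1 character_torus3 !exp1rz !mul1r !mxE inordK //.
  move: bs; rewrite !inE => /or3P[] /eqP ->.
  - have -> : pairing (tv 26) 6 = 0 by vm_compute.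
    by rewrite expr0z.
  - have -> : pairing (tv 14) 6 = 0 by vm_compute.
    by rewrite expr0z.
  - have -> : pairing (tv 0) 6 = 2 by vm_compute.
    by rewrite -exprnP sqrrN expr1n.
rewrite -{1}[f.@[_]]mul1r (inj_eq (mulIf (base_point_neq0 ff fm f0))) eq_sym.
have N1 n : (-1 : F) ^+ n = 1 -> n = (n./2 * 2)%N.
  rewrite -signr_odd muln2 => /eqP; case: (boolP (odd n)) => [_|on _]; last first.
    by rewrite -[LHS]odd_double_half (negPf on).
  by rewrite expr1 eq_sym -subr_eq0 opprK -mulr2n pnatr_eq0.
case: (mu 0 _) => n /eqP.
  by rewrite -exprnP => /N1 {1}->; exists (n./2%:Z); rewrite PoszM.
rewrite NegzE -invr_expz => /eqP; rewrite invr_eq1 -exprnP => /eqP/N1 ->.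
by exists (- ((n.+1)./2)%:Z); rewrite mulNr PoszM.
Qed.

(** Otherwise cancel h ^+ A and evaluate at x: a factor h remains on the left, while the right side
    is nonzero. *)
Lemma valuation_le h f g g' x N A (c : F) :
  f * g * h ^+ N = c *: (g' * h ^+ A) -> h != 0 -> h.@[x] = 0 ->
  g'.@[x] != 0 -> c != 0 -> (N <= A)%N.
Proof.
move=> E h0 hx gx c0; rewrite leqNgt; apply/negP => AN.
move: E; rewrite -(subnK AN) addnS -addSn exprD mulrA scalerAl.
have hA0 : h ^+ A != 0 by rewrite expf_neq0.
move/(mulIf hA0)/(congr1 (meval x)); rewrite mevalZ exprS !mevalM hx mul0r mulr0.
by move/esym/eqP; rewrite mulf_eq0 (negPf c0) (negPf gx).
Qed.

Lemma classification f mu : levi_fixed f -> has_weight mu f -> f != 0 ->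
  exists i j k c, [/\ c != 0, f = c *: hmon i j k & mu = hweight i j k].
Proof.
move=> ff fm f0.
have fo := base_point_neq0 ff fm f0.
have [l mul] := even_weight ff fm f0.
set m := mu 0 (inord 0); set n := mu 0 (inord 5).
(* The coordinates of mu are not yet known to be nonnegative; multiplying f by (h1 h2 h3)^N shifts
   them into the naturals. *)
have [N [A [B [E [mA nB lE]]]]] : exists N A B E : nat,
    [/\ m + N%:Z = A%:Z, n + N%:Z = B%:Z & l + N%:Z = E%:Z].
  pose N := (absz m + absz n + absz l)%N.
  have pos (z : int) : (absz z <= N)%N -> exists A : nat, z + N%:Z = A%:Z.
    move=> zN; exists (absz (z + N%:Z)); rewrite gez0_abs //.
    by rewrite -lerBlDl sub0r (le_trans (ler_norm _)) // normrN -abszE lez_nat.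
  have [|A mA] := pos m; first by rewrite /N -addnA leq_addr.
  have [|B nB] := pos n; first by rewrite /N addnAC leq_addl.
  have [|E lE] := pos l; first by rewrite /N leq_addl.
  by exists N, A, B, E.
have [C C0 CE] : exists2 C, C != 0 & f * (h1 * h2 * h3) ^+ N = C *: hmon A B E.
  pose o2 := h2.@[base_point]; pose o3 := h3.@[base_point].
  have o20 : o2 != 0 := h2_base F.
  have o30 : o3 != 0 := h3_base F.
  (* The only possible constant, found by evaluating at the base point, where [h1] is 1. *)
  exists (f.@[base_point] * (o2 * o3) ^+ N / (o2 ^+ B * o3 ^+ E)).
    by rewrite !mulf_neq0 ?invr_eq0 ?expf_neq0 ?mulf_neq0 ?expf_neq0.
  (* Multiplying by h1 h2 h3 leaves only generic points to check. *)
  apply/eqP; rewrite -subr_eq0; apply/eqP/(mulIf (hmon_neq0 1 1 1)).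
  rewrite mul0r; apply: meval_eq0 => x; rewrite mevalM.
  have [->|] := eqVneq (hmon 1 1 1).@[x] 0; first by rewrite mulr0.
  rewrite !mevalM !expr1 !mulf_eq0 !negb_or => /andP[/andP[x1 x2] x3].
  have [u [v [w [u0 v0 w0 gen]]]] := generic_point x1 x2 x3.
  have w20 : w ^+ 2 != 0 by rewrite expf_neq0.
  have h1x : h1.@[x] = u.
    rewrite (gen _ _ (@h1_fixed F) (@has_weight_h1 F)) !delta_inord //= h1_base.
    by rewrite expr1z !expr0z !mulr1.
  have h2x : h2.@[x] = v * o2.
    rewrite (gen _ _ (@h2_fixed F) (@has_weight_h2 F)) !delta_inord //=.
    by rewrite expr1z !expr0z mul1r mulr1.
  have h3x : h3.@[x] = w ^+ 2 * o3.
    rewrite (gen _ _ (@h3_fixed F) (@has_weight_h3 F)) !mulmxnE !delta_inord //=.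
    by rewrite !mul0rn !expr0z !mul1r.
  have fx : f.@[x] * (u * v * w ^+ 2) ^+ N = u ^+ A * v ^+ B * (w ^+ 2) ^+ E * f.@[base_point].
    have wl : w ^ (2 * l) = (w ^+ 2) ^ l by rewrite -exprz_exp.
    rewrite (gen f mu ff fm) -/m -/n mul [l * 2]mulrC wl.
    move: (w ^+ 2) w20 => q q0.
    rewrite !exprMn !(exprnP _ N) !(exprnP _ A) !(exprnP _ B) !(exprnP _ E).
    by rewrite -mA -nB -lE !expfzDr //; ring.
  rewrite mevalB mevalZ hmonE !mevalM !rmorphXn /= !mevalM h1x h2x h3x.
  have -> : u * (v * o2) * (w ^+ 2 * o3) = u * v * w ^+ 2 * (o2 * o3) by ring.
  rewrite [(u * v * _ * _) ^+ N]exprMn [f.@[x] * (_ * _)]mulrA fx.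
  rewrite [(v * o2) ^+ B]exprMn [(_ * o3) ^+ E]exprMn.
  have o2B0 : o2 ^+ B != 0 by rewrite expf_neq0.
  have o3E0 : o3 ^+ E != 0 by rewrite expf_neq0.
  move: (o2 ^+ B) (o3 ^+ E) (u ^+ A) (v ^+ B) (_ ^+ E) (_ ^+ N) o2B0 o3E0 => *.
  by field; apply/andP.
have NA : (N <= A)%N.
  have [x [x1 x2 x3]] := h1_zero_point F.
  apply: (@valuation_le h1 f (h2 ^+ N * h3 ^+ N) (h2 ^+ B * h3 ^+ E) x N A C) => //.
  - have -> : h2 ^+ B * h3 ^+ E * h1 ^+ A = hmon A B E by rewrite !hmonE; ring.
    by rewrite -CE !exprMn; ring.
  - exact: h1_neq0.
  - by rewrite mevalM !rmorphXn mulf_neq0 ?expf_neq0.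
have NB : (N <= B)%N.
  have [x [x1 x2 x3]] := h2_zero_point F.
  apply: (@valuation_le h2 f (h1 ^+ N * h3 ^+ N) (h1 ^+ A * h3 ^+ E) x N B C) => //.
  - have -> : h1 ^+ A * h3 ^+ E * h2 ^+ B = hmon A B E by rewrite !hmonE; ring.
    by rewrite -CE !exprMn; ring.
  - exact: h2_neq0.
  - by rewrite mevalM !rmorphXn mulf_neq0 ?expf_neq0.
have NE : (N <= E)%N.
  have [x [x1 x2 x3]] := h3_zero_point F.
  apply: (@valuation_le h3 f (h1 ^+ N * h2 ^+ N) (h1 ^+ A * h2 ^+ B) x N E C) => //.
  - by rewrite -/(hmon A B E) -CE !exprMn; ring.
  - exact: h3_neq0.
  - by rewrite mevalM !rmorphXn mulf_neq0 ?expf_neq0.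
have fE : f = C *: hmon (A - N) (B - N) (E - N).
  apply: (mulIf (hmon_neq0 N N N)).
  have -> : f * hmon N N N = C *: hmon A B E by rewrite -CE !hmonE !exprMn.
  rewrite -scalerAl; congr (_ *: _).
  rewrite !hmonE -{1}(subnK NA) -{1}(subnK NB) -{1}(subnK NE) !exprD; ring.
exists (A - N)%N, (B - N)%N, (E - N)%N, C; split=> //.
apply: (has_weight_uniq f0 fm); rewrite fE.
exact/has_weightZ/hmon_weight.
Qed.

End Classification.

(** * Submodules and multiplicity-freeness *)

Section HighestWeightVectors.

Variable F : numClosedFieldType.
Local Notation sym := (sym F).
Local Notation D := (@root_deriv F).
Local Notation h1 := (h1 F).
Local Notation h2 := (h2 F).
Local Notation h3 := (h3 F).
Local Notation hmon := (hmon F).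
Implicit Types (x : 'I_27 -> F) (f p q : sym) (lam : weight).

Lemma highest_weight_vectorP lam f :
  highest_weight_vector (@sym_act F) lam f ->
  exists i j k c, [/\ c != 0, f = c *: hmon i j k & lam = hweight i j k].
Proof.
case=> f0 ft fe; apply: classification f0; last exact/has_weightP.
by move=> a c ap a0; apply: fe.
Qed.

Lemma hmon_highest_weight i j k :
  highest_weight_vector (@sym_act F) (hweight i j k) (hmon i j k).
Proof.
split; first exact: hmon_neq0.
  exact/has_weightP/hmon_weight.
move=> a c ap a0; apply: killed_levi_fixed => // b bs; exact: D_hmon.
Qed.

Lemma hweight_degree i j k : highest_weight_degree F (hweight i j k) (i + 2 * j + 3 * k).
Proof.
move=> h /highest_weight_vectorP[i' [j' [k' [c [_ -> /hweight_inj[-> -> ->]]]]]].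
exact/dhomogZ/hmon_homog.
Qed.

Lemma submodule_subspace (H : (e7 F -> e7 F) -> Prop) (V : lmodType F) act (W : V -> Prop) :
  submodule H act W -> subspace W.
Proof. by case=> W0 Wl _; split. Qed.

Lemma levi_submodule_D W a : submodule (@levi_P7 F) (@sym_act F) W ->
  a \in levi_roots -> forall p, W p -> W (D a p).
Proof.
move=> Wm /levi_root_exists[r <- r0]; apply: closed_exp_D => // [|c p Wp].
  exact: submodule_subspace Wm.
by case: Wm => _ _; apply=> //; apply: exp_in_levi.
Qed.

(** Stability under the Levi part is the weaker assumption, so this serves both for it and for
    [P7]. *)
Lemma levi_submodule_generated W p : submodule (@levi_P7 F) (@sym_act F) W ->
  W p -> p != 0 ->
  exists i j k, W (hmon i j k) /\ forall q, generated (hmon i j k) q -> W q.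
Proof.
move=> Wm Wp p0; have Wsub := submodule_subspace Wm.
have [t t0 q Wq|a als|w [mu [Ww w0 wm Dw]]] := exists_highest_weight Wsub _ _ Wp p0.
- by case: Wm => _ _; apply=> //; apply: torus_in_levi.
- by apply: levi_submodule_D => //; apply/levi_pos_roots/levi_simple_pos.
have [i [j [k [c [c0 wE _]]]]] := classification (killed_levi_fixed Dw) wm w0.
rewrite wE in Ww; have {}Ww := subspaceZ_inv Wsub c0 Ww.
exists i, j, k; split=> //; apply: generated_min => // a al q Wq.
by apply: levi_submodule_D => //; apply: levi_simple_neg_roots.
Qed.

Lemma generated_submodule H i j k : (forall s, H s -> P7 s) ->
  submodule H (@sym_act F) (generated (hmon i j k)).
Proof.
move=> HP; split; [exact: span_of0 | exact: (generated_subspace _).2 |].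
move=> s /HP Ps v gv; apply: (generated_P7 (@hmon_weight F i j k)) => // a al.
exact: D_hmon.
Qed.

Lemma irreducible_generated W : irreducible_module (@levi_P7 F) (@sym_act F) W ->
  exists i j k, forall q, W q <-> generated (hmon i j k) q.
Proof.
case=> Wm [p Wp p0] Wmin.
have [i [j [k [Wh gW]]]] := levi_submodule_generated Wm Wp p0.
exists i, j, k => q; split; last exact: gW.
case: (Wmin (generated (hmon i j k))) => //.
- by apply: generated_submodule; apply: levi_P7_sub.
- move=> z; have := z _ (generated_self _) => /eqP.
  by rewrite (negPf (hmon_neq0 F i j k)).
- exact.
Qed.

(** An isomorphism sends [hmon i j k] to a highest weight vector of the same weight, which by the
    classification is a multiple of [hmon i j k] itself. So W2 contains W1, and irreducibility gives
    equality. *)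
Lemma sym_multiplicity_free : multiplicity_free (@levi_P7 F) (@sym_act F).
Proof.
move=> W1 W2 irr1 irr2 [f [fW fl fact finj _]].
have [i [j [k W1E]]] := irreducible_generated irr1.
have W1h : W1 (hmon i j k) by apply/W1E/generated_self.
have W10 : W1 0 by case: irr1 => [[]].
have f0 : f 0 = 0.
  by have := fl 1 0 0 W10 W10; rewrite scaler0 addr0 scale1r -[LHS]addr0 => /addrI.
have fZ c u : W1 u -> f (c *: u) = c *: f u.
  by move=> Wu; rewrite -[c *: u]addr0 fl // f0 addr0.
have [h0 ht he] := hmon_highest_weight i j k.
have hwf : highest_weight_vector (@sym_act F) (hweight i j k) (f (hmon i j k)).
  split.
  - by apply: contraNneq h0 => fh; apply/eqP/finj; rewrite ?f0.
  - by move=> t t0; rewrite -fact ?ht ?fZ //; apply: torus_in_levi.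
  - by move=> a c ap a0; rewrite -fact ?he //; apply: exp_in_levi.
have [i' [j' [k' [c [c0 fE]]]]] := highest_weight_vectorP hwf.
case/hweight_inj=> ii jj kk; subst i' j' k'.
have W2m : submodule (@levi_P7 F) (@sym_act F) W2 by case: irr2.
have W2h : W2 (hmon i j k).
  apply: (subspaceZ_inv (submodule_subspace W2m) c0); rewrite -fE; exact: fW.
have W12 v : W1 v -> W2 v.
  move/W1E; move: v; apply: generated_min => // [|a al p W2p].
    exact: submodule_subspace W2m.
  by apply: levi_submodule_D => //; apply: levi_simple_neg_roots.
case: irr2 => _ _ /(_ W1) [||W1z|W21] //; first by case: irr1.
  by move: h0; rewrite (W1z _ W1h) eqxx.
by move=> v; split; [apply: W12 | apply: W21].
Qed.

End HighestWeightVectors.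

(** * Irreducibility of the basic invariants *)

Section Irreducibility.

Variable F : numClosedFieldType.
Local Notation sym := (sym F).
Local Notation D := (@root_deriv F).
Local Notation h1 := (h1 F).
Local Notation h2 := (h2 F).
Local Notation h3 := (h3 F).
Local Notation hmon := (hmon F).
Implicit Types (x : 'I_27 -> F) (f p q : sym) (lam : weight) (a : Defs.root).

Lemma iter_DD v k p q :
  iter k (D v) (p + q) = iter k (D v) p + iter k (D v) q.
Proof. by have := iter_D_linear v k 1 p q; rewrite !scale1r. Qed.

Lemma iter_DM_const v k p q : D v p = 0 ->
  iter k (D v) (p * q) = p * iter k (D v) q.
Proof. by move=> Dp; elim: k => //= k ->; rewrite DM Dp mul0r add0r. Qed.

(** Every other term of the Leibniz formula has too many derivatives on one of the factors. *)
Lemma iter_D_top v n m p q :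
  iter n.+1 (D v) p = 0 -> iter m.+1 (D v) q = 0 ->
  iter (n + m) (D v) (p * q) = 'C(n + m, n)%:R *: (iter n (D v) p * iter m (D v) q).
Proof.
have [s] := ubnP (n + m); elim: s n m p q => // s IH [|n] m p q sm Dp Dq.
  by rewrite bin0 scale1r iter_DM_const.
case: m sm Dq => [|m] sm Dq.
  by rewrite addn0 binn scale1r mulrC iter_DM_const // mulrC.
rewrite addSn iterSr DM iter_DD IH -?iterSr //.
rewrite -addSnnS (IH n.+1 m) -?iterSr //; last by rewrite addSnnS.
rewrite -scalerDl -natrD; congr (_%:R *: _).
by rewrite binS addnC.
Qed.

Lemma iter_D_msize a p : coef a 6 = 0 -> iter (msize p) (D (val a)) p = 0.
Proof.
move=> a0; rewrite {2}[p]mpolyE big_seq.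
apply: (big_ind (fun q => iter (msize p) (D (val a)) q = 0)) => [|q r Hq Hr|m mp].
- exact: iter_D0.
- by rewrite -[q]scale1r iter_D_linear Hq Hr scaler0 addr0.
- rewrite -[_ *: _]addr0 iter_D_linear iter_D0 addr0.
  by have [-> _] := iter_D_monomial F a0 (msize_mdeg_lt mp); rewrite scaler0.
Qed.

(** Let n and m be the largest orders at which the iterates of D a on p and q are nonzero. The
    iterate n + m on p q is a nonzero multiple of a product of nonzero polynomials, so D a (p q) = 0
    forces n = 0. *)
Lemma D_factor a p q : coef a 6 = 0 -> p * q != 0 ->
  D (val a) (p * q) = 0 -> D (val a) p = 0.
Proof.
move=> a0 pq0 Dpq.
have top r : r != 0 -> exists n, iter n.+1 (D (val a)) r = 0 /\ iter n (D (val a)) r != 0.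
  move=> r0; have ex : exists n, iter n (D (val a)) r == 0.
    by exists (msize r); rewrite iter_D_msize.
  case: (ex_minnP ex) => [[|n]] /eqP n0 nmin.
    by move: r0; rewrite -[r]/(iter 0 (D (val a)) r) n0 eqxx.
  exists n; split=> //; apply/negP => /nmin; by rewrite ltnn.
move: (pq0); rewrite mulf_eq0 negb_or => /andP[/top[n [n1 n0]] /top[m [m1 m0]]].
have := iter_D_top n1 m1.
case: n n1 n0 => [//|n] n1 n0.
rewrite addSn iterSr Dpq iter_D0 => /esym/eqP.
by rewrite scaler_eq0 mulf_eq0 (negPf n0) (negPf m0) pnatr_eq0 eqn0Ngt bin_gt0 leq_addr.
Qed.

Lemma msize_homog d p : p != 0 -> p \is d.-homog -> msize p = d.+1.
Proof. by move=> p0 /dhomogP/(_ _ (mlead_supp p0)) /= <-; rewrite mlead_deg. Qed.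

Lemma unit_msize p : p \is a GRing.unit -> msize p = 1%N.
Proof.
move=> pu; have p0 : p != 0 by apply: contraTneq pu => ->; rewrite unitr0.
have i0 : p^-1 != 0 by rewrite invr_eq0.
have := msizeM p0 i0; rewrite divrr // msize1.
have : (0 < msize p)%N by rewrite lt0n msize_poly_eq0.
have : (0 < msize p^-1)%N by rewrite lt0n msize_poly_eq0.
by move: (mmeasure mdeg p^-1) (mmeasure mdeg p) => u v; lia.
Qed.

Lemma msize_unit p : p != 0 -> (msize p <= 1)%N -> p \is a GRing.unit.
Proof.
move=> p0 /msize1_polyC pE; rewrite pE; apply: rmorph_unit; rewrite unitfE.
by apply: contraNneq p0 => p00; rewrite pE p00 mpolyC0.
Qed.

Lemma affineE p : (msize p <= 2)%N ->
  p = (p@_0)%:MP + \sum_(b < 27) p@_U_(b) *: 'X_b.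
Proof.
move=> p2; apply/mpolyP => m; rewrite mcoeffD mcoeffC raddf_sum /=.
under eq_bigr => b _ do rewrite mcoeffZ mcoeffX.
have [->|m0] := eqVneq m 0%MM.
  by rewrite mulr1 big1 ?addr0 // => b _; rewrite mnm1_eq0 mulr0.
rewrite mulr0 add0r; have [/mdeg1P[e /eqP ->]|m1] := boolP (mdeg m == 1%N).
  rewrite (bigD1 e) //= eqxx mulr1 big1 ?addr0 // => b be.
  by rewrite eq_mnm1 (negPf be) mulr0.
rewrite big1 => [|b _].
  apply: memN_msupp_eq0; apply: msize_mdeg_ge; apply: leq_trans p2 _.
  move: m0 m1; rewrite -mdeg_eq0; by case: (mdeg m) => [|[|]].
have [mE|_] := eqVneq U_(b)%MM m; last by rewrite mulr0.
by rewrite -mE mdeg1 in m1.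
Qed.

(** Every variable but the last is raised by some simple root to a variable that no other one
    reaches, so its coefficient is 0. The constant term stays because factors are not known to be
    homogeneous. *)
Lemma killed_affine p : (msize p <= 2)%N ->
  (forall v, v \in levi_simple -> D v p = 0) ->
  exists c0 c, p = c0%:MP + c *: h1.
Proof.
move=> p2 Dp; exists p@_0, p@_(U_(ord_max)); rewrite {1}(affineE p2); congr (_ + _).
rewrite (bigD1 ord_max) //= big1 ?addr0 // => b bmax.
suff -> : p@_U_(b) = 0 by rewrite scale0r.
have b26 : (b < 26)%N by rewrite ltn_neqAle -ltnS ltn_ord andbT.
have /allP/(_ b) : all (fun b => has (fun v => vadd v (tv b) \in tvecs) levi_simple) (iota 0 26).
  by vm_compute.
rewrite mem_iota => /(_ b26)/hasP[a al /tvecsP[e be]].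
have := Dp a al; rewrite {1}(affineE p2) linearD linear_sum /=.
have -> : D a (p@_0)%:MP = 0.
  rewrite -alg_mpolyC linearZ /=.
  suff -> : D a 1 = 0 by rewrite scaler0.
  by have := @D_expr F a 0 0; rewrite linear0 expr0; apply.
rewrite add0r => /(congr1 (mcoeff U_(e))).
rewrite raddf_sum mcoeff0 /= (bigD1 b) //= big1 ?addr0 => [|d db].
  rewrite linearZ /= DX be Xv_tv !mcoeffZ mcoeffX eqxx mulr1 => /eqP.
  rewrite mulf_eq0 intr_eq0 /epsz; case: ifP => _; rewrite ?oppr_eq0 ?orbF => /eqP //.
rewrite linearZ /= DX !mcoeffZ.
have [/tvecsP[e' de]|/Xv_out ->] := boolP (vadd a (tv d) \in tvecs); last by rewrite mcoeff0 !mulr0.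
rewrite de Xv_tv mcoeffX eq_mnm1; case: eqP => [ee|_]; last by rewrite !mulr0.
case/eqP: db; apply: tv_inj.
by rewrite -(@vaddKN a (tv d)) ?de ?ee -?be ?vaddKN // size_tvecs ?tv_in.
Qed.

(** If c0 is nonzero, the torus moves the base point to a point where [h1] equals -c0 / c, and f,
    being a weight vector, stays nonzero there. *)
Lemma affine_zero f mu c0 c : levi_fixed f -> has_weight mu f ->
  f.@[@base_point F] != 0 -> (exists x, h1.@[x] = 0 /\ f.@[x] != 0) -> c != 0 ->
  exists x, (c0%:MP + c *: h1).@[x] = 0 /\ f.@[x] != 0.
Proof.
move=> ff fm fo [x [x1 x0]] c0'.
have [->|c00] := eqVneq c0 0.
  by exists x; rewrite mpolyC0 add0r mevalZ x1 mulr0.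
have z0 : - c0 / c != 0 by rewrite mulf_neq0 ?oppr_eq0 ?invr_eq0.
have t0 := torus3_neq0 z0 (oner_neq0 F) (oner_neq0 F).
exists (fun b : 'I_27 => character (vec_weight (tv b)) (torus3 (- c0 / c) 1 1) * base_point F b).
rewrite (torus_eval _ t0 fm) mevalD mevalC mevalZ (torus_eval _ t0 (@has_weight_h1 F)).
rewrite h1_base !character_torus3 !exp1rz delta_inord //= expr1z !mulr1.
split; first by field.
by rewrite mulf_neq0 // expfz_neq0.
Qed.

(** In degree 2 or 3 a factorisation into non-units has a factor of degree one; in degree 1 there is
    none. *)
Lemma irreducible_killed d f mu : f \is d.-homog -> (0 < d <= 3)%N ->
  (forall v, v \in levi_simple -> D v f = 0) -> has_weight mu f ->
  f.@[@base_point F] != 0 ->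
  ((1 < d)%N -> exists x, h1.@[x] = 0 /\ f.@[x] != 0) -> irreducible_mpoly f.
Proof.
move=> fd /andP[d0 d3] Df fm fo fx.
have f0 : f != 0 by apply: contraNneq fo => ->; rewrite meval0.
have fs := msize_homog f0 fd.
split=> // [|q1 q2 fE]; first by apply: contraL d0 => /unit_msize; rewrite fs => -[->].
have affine p q : f = p * q -> p \isn't a GRing.unit -> (msize p <= 2)%N -> (1 < d)%N -> False.
  move=> {}fE pu p2 d1.
  have p0 : p != 0 by apply: contraNneq f0 => p0; rewrite fE p0 mul0r.
  have [|c0 [c pE]] := killed_affine p2.
    move=> a al; have [r [rE _ r0]] := levi_pos_exists (levi_simple_pos al).
    by rewrite -rE; apply: (@D_factor _ _ q) => //; rewrite -fE // rE Df.
  have cn0 : c != 0.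
    apply: contraNneq pu => c0'; apply: msize_unit => //.
    by rewrite pE c0' scale0r addr0 msizeC; case: (_ != _).
  have [x [px]] := affine_zero c0 (killed_levi_fixed Df) fm fo (fx d1) cn0.
  by rewrite fE mevalM pE px mul0r eqxx.
have [u1|u1] := boolP (q1 \is a GRing.unit); first by left.
have [u2|u2] := boolP (q2 \is a GRing.unit); first by right.
move: (f0); rewrite fE mulf_eq0 negb_or => /andP[q10 q20].
have s1 : (1 < msize q1)%N by rewrite ltnNge; apply: contra u1; apply: msize_unit.
have s2 : (1 < msize q2)%N by rewrite ltnNge; apply: contra u2; apply: msize_unit.
have sE : d.+1 = (msize q1 + msize q2).-1 by rewrite -fs {1}fE msizeM.
have d1 : (1 < d)%N by lia.
have [q1s|q1s] := leqP (msize q1) 2; first by case: (affine q1 q2).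
by case: (affine q2 q1) => //; [rewrite mulrC | lia].
Qed.

Lemma h1_irreducible : irreducible_mpoly h1.
Proof.
apply: (irreducible_killed (h1_homog F)) => //.
- by move=> a al; apply: D_h1.
- exact: has_weight_h1.
- by rewrite h1_base oner_neq0.
Qed.

Lemma h2_irreducible : irreducible_mpoly h2.
Proof.
apply: (irreducible_killed (h2_homog F)) => //.
- by move=> a al; apply: D_h2.
- exact: has_weight_h2.
- exact: h2_base.
- by move=> _; have [x [x1 x2 _]] := h1_zero_point F; exists x.
Qed.

Lemma h3_irreducible : irreducible_mpoly h3.
Proof.
apply: (irreducible_killed (h3_homog F)) => //.
- by move=> a al; apply: D_h3.
- exact: has_weight_h3.
- exact: h3_base.
- by move=> _; have [x [x1 _ x3]] := h1_zero_point F; exists x.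
Qed.

Lemma lambda1E : lambda1 = hweight 1 0 0.
Proof. by rewrite /hweight !mulr0n !addr0. Qed.

Lemma lambda6E : lambda6 = hweight 0 1 0.
Proof. by rewrite /hweight !mulr0n addr0 add0r. Qed.

Lemma lambda7E : lambda7 *+ 2 = hweight 0 0 1.
Proof. by rewrite /hweight !mulr0n !add0r. Qed.

(** For the direct implication, split one basic invariant off c h1^i h2^j h3^k: irreducibility makes
    the cofactor a unit, hence of degree 0. *)
Lemma fundamental_highest_weightE lam : fundamental_highest_weight F lam <->
  lam \in [:: lambda1; lambda6; lambda7 *+ 2].
Proof.
rewrite !inE; split; last first.
  have hw1 : hmon 1 0 0 = h1 by rewrite hmonE !expr0 !mulr1.
  have hw2 : hmon 0 1 0 = h2 by rewrite hmonE !expr0 mulr1 mul1r.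
  have hw3 : hmon 0 0 1 = h3 by rewrite hmonE !expr0 !mul1r.
  rewrite {1}lambda1E {1}lambda6E {1}lambda7E.
  case/or3P=> /eqP ->.
  - by exists (hmon 1 0 0); [exact: hmon_highest_weight | rewrite hw1; exact: h1_irreducible].
  - by exists (hmon 0 1 0); [exact: hmon_highest_weight | rewrite hw2; exact: h2_irreducible].
  - by exists (hmon 0 0 1); [exact: hmon_highest_weight | rewrite hw3; exact: h3_irreducible].
case=> h /highest_weight_vectorP[i [j [k [c [c0 -> ->]]]]] [_ hu hirr].
have rest i' j' k' : (c *: hmon i' j' k' \is a GRing.unit) -> (i' + 2 * j' + 3 * k' = 0)%N.
  move/unit_msize; rewrite (@msize_homog (i' + 2 * j' + 3 * k')) => [[]//||].
    by rewrite scaler_eq0 negb_or c0 hmon_neq0.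
  exact/dhomogZ/hmon_homog.
have nu p d : p \is d.+1.-homog -> p != 0 -> p \isn't a GRing.unit.
  by move=> pd p0; apply/negP => /unit_msize; rewrite (msize_homog p0 pd).
case: i => [|i] in hu hirr *.
  case: j => [|j] in hu hirr *.
    case: k => [|k] in hu hirr *.
      case/negP: hu; apply: msize_unit.
        by rewrite scaler_eq0 negb_or c0 hmon_neq0.
      rewrite (@msize_homog 0) ?scaler_eq0 ?negb_or ?c0 ?hmon_neq0 //.
      exact: dhomogZ (hmon_homog F 0 0 0).
    case: (hirr h3 (c *: hmon 0 0 k)).
    - by rewrite -scalerAr !hmonE exprS; congr (_ *: _); ring.
    - by move=> h3u; case/negP: (nu _ _ (h3_homog F) (h3_neq0 F)).
    move/rest => k0; have -> : k = 0%N by lia.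
    by rewrite -lambda7E eqxx !orbT.
  case: (hirr h2 (c *: hmon 0 j k)).
  - by rewrite -scalerAr !hmonE exprS; congr (_ *: _); ring.
  - by move=> h2u; case/negP: (nu _ _ (h2_homog F) (h2_neq0 F)).
  move/rest => jk0; have [-> ->] : j = 0%N /\ k = 0%N by lia.
  by rewrite -lambda6E eqxx !orbT.
case: (hirr h1 (c *: hmon i j k)).
- by rewrite -scalerAr !hmonE exprS; congr (_ *: _); ring.
- by move=> h1u; case/negP: (nu _ _ (h1_homog F) (h1_neq0 F)).
move/rest => ijk0; have [-> [-> ->]] : i = 0%N /\ j = 0%N /\ k = 0%N by lia.
by rewrite -lambda1E eqxx.
Qed.

End Irreducibility.

(** * The decomposition *)

(** Excluded middle yields a vector of W outside U or shows U = W; adding the vector lowers the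
    codimension. *)
Lemma subspace_vspace (F : fieldType) (V : vectType F) (W : V -> Prop) :
  subspace W -> exists U : {vspace V}, forall v, v \in U <-> W v.
Proof.
case=> W0 Wl; have key n (U : {vspace V}) : (forall v, v \in U -> W v) ->
    (\dim {:V} - \dim U < n)%N -> exists U : {vspace V}, forall v, v \in U <-> W v.
  elim: n U => // n IH U UW Un.
  have [[w [Ww wU]]|UWe] := boolp.pselect (exists w, W w /\ w \notin U); last first.
    exists U => v; split=> [/UW //|Wv]; apply/negPn/negP => vU; apply: UWe.
    by exists v.
  have Uw : ~~ (<[w]> + U <= U)%VS.
    by apply: contra wU => /subvP; apply; apply: subvP (addvSl _ _) _ (memv_line w).
  apply: (IH (<[w]> + U)%VS) => [v /memv_addP[_ /vlineP[c ->] [u Uu ->]]|].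
    by apply: Wl => //; apply: UW.
  have dU : (\dim U < \dim (<[w]> + U))%N.
    by rewrite (ltn_leqif (dimv_leqif_sup (addvSr _ _))).
  have dV := dimvS (subvf (<[w]> + U)%VS); lia.
apply: (key (\dim {:V}).+1 0%VS) => [v|]; first by rewrite memv0 => /eqP ->.
by rewrite dimv0 subn0.
Qed.

(** * The Fischer inner product *)

Section Fischer.

Variable F : numClosedFieldType.
Local Notation sym := (sym F).
Local Notation D := (@root_deriv F).
Implicit Types (p q : sym) (mu : weight).

Definition mfact n (m : 'X_{1..n}) : nat := (\prod_(i < n) (m i)`!)%N.

Lemma mfactU n (m : 'X_{1..n}) i : mfact (m + U_(i)) = (mfact m * (m i).+1)%N.
Proof.
rewrite /mfact (bigD1 i) //= [in RHS](bigD1 i) //= mnmDE mnm1E eqxx addn1 factS.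
rewrite (eq_bigr (fun j => (m j)`!)); first by rewrite -mulnA mulnC.
by move=> j ji; rewrite mnmDE mnm1E eq_sym (negPf ji) addn0.
Qed.

Lemma mfact_gt0 n (m : 'X_{1..n}) : (0 < mfact m)%N.
Proof. by apply: prodn_gt0 => i; apply: fact_gt0. Qed.

(** Distinct monomials are orthogonal and X^m has square norm m!; the bound N on the degree keeps
    the sum finite. *)
Definition fischer N p q : F :=
  \sum_(m : 'X_{1..27 < N}) (mfact m)%:R * p@_m * (q@_m)^*.

Lemma fischerDl N c p q r : fischer N (c *: p + q) r = c * fischer N p r + fischer N q r.
Proof.
rewrite /fischer mulr_sumr -big_split; apply: eq_bigr => m _ /=.
by rewrite mcoeffD mcoeffZ; ring.
Qed.

Lemma fischer0l N q : fischer N 0 q = 0.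
Proof. by apply: big1 => m _; rewrite mcoeff0 mulr0 mul0r. Qed.

Lemma fischerC N p q : fischer N q p = (fischer N p q)^*.
Proof.
rewrite /fischer rmorph_sum; apply: eq_bigr => m _.
by rewrite !rmorphM /= conjCK conjC_nat mulrAC.
Qed.

Lemma fischer0r N q : fischer N q 0 = 0.
Proof. by rewrite fischerC fischer0l conjC0. Qed.

Lemma fischerDr N c p q r :
  fischer N r (c *: p + q) = c^* * fischer N r p + fischer N r q.
Proof. by rewrite fischerC fischerDl rmorphD rmorphM /= -!fischerC. Qed.

Lemma fischer_subspacer N q : subspace (fun p => fischer N q p = 0).
Proof.
by split=> [|c u v pu pv]; rewrite ?fischer0r // fischerDr pu pv mulr0 addr0.
Qed.

Lemma fischer_def N p : (msize p <= N)%N -> fischer N p p = 0 -> p = 0.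
Proof.
move=> pN /eqP; rewrite psumr_eq0 => [/allP p0|m _]; last first.
  by rewrite -mulrA mulr_ge0 ?ler0n ?mul_conjC_ge0.
apply/mpolyP => m; rewrite mcoeff0.
have [mN|Nm] := ltnP (mdeg m) N; last by apply/memN_msupp_eq0/msize_mdeg_ge/(leq_trans pN).
have := p0 (BMultinom mN); rewrite mem_index_enum => /(_ isT).
by rewrite /= -mulrA mulf_eq0 pnatr_eq0 eqn0Ngt mfact_gt0 mul_conjC_eq0 => /eqP.
Qed.

Lemma fischer_weight N mu nu p q : has_weight mu p -> has_weight nu q -> mu != nu ->
  fischer N p q = 0.
Proof.
move=> pm qn; apply: contraNeq => /eqP pq; apply: contra_notT pq => mn.
apply: big1 => m _; have [mp|/memN_msupp_eq0 ->] := boolP (val m \in msupp p); last first.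
  by rewrite mulr0 mul0r.
have [mq|/memN_msupp_eq0 ->] := boolP (val m \in msupp q); last by rewrite conjC0 mulr0.
by case/eqP: mn; rewrite -(pm _ mp) (qn _ mq).
Qed.

Lemma fischer_torus N t p q : (forall i, t i != 0) ->
  fischer N (sym_act (torus t) p) q =
  fischer N p (sym_act (torus (fun i => (t i)^*)) q).
Proof.
move=> t0; apply: eq_bigr => m _; rewrite !mcoeff_torus //; last first.
  by move=> i; rewrite conjC_eq0.
have -> : character (wt m) t = (character (wt m) (fun i => (t i)^*))^*.
  by rewrite /character rmorph_prod; apply: eq_bigr => i _; rewrite fmorphXz /= conjCK.
by rewrite rmorphM /=; ring.
Qed.

Lemma fischer_monomial N m q : fischer N 'X_[m] q =
  if (mdeg m < N)%N then (mfact m)%:R * (q@_m)^* else 0.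
Proof.
case: ifP => [mN|Nm].
  rewrite /fischer (bigD1 (BMultinom mN)) //= mcoeffX eqxx mulr1 big1 ?addr0 // => n nm.
  rewrite mcoeffX; case: eqP => [mn|_]; last by rewrite mulr0 mul0r.
  by case/eqP: nm; apply: val_inj.
apply: big1 => n _; rewrite mcoeffX; case: eqP => [mn|_]; last by rewrite mulr0 mul0r.
by have := bmdeg n; rewrite -mn Nm.
Qed.

(** Multiplication by a variable is adjoint to the partial derivative. The operators composed here
    preserve the degree, so the truncation at N does no harm. *)
Lemma fischer_elementary N (b e : 'I_27) p q :
  fischer N ('X_e * p^`M(b)) q = fischer N p ('X_b * q^`M(e)).
Proof.
elim/mpolyind: p => [|c m p _ _ IH].
  by rewrite linear0 mulr0 !fischer0l.
rewrite linearP /= mulrDr -scalerAr !fischerDl IH; congr (_ * _ + _) => {c p IH}.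
rewrite mderivX -scalerAr fischer_monomial.
have [mb|mb] := eqVneq (m b) 0%N.
  rewrite mb scale0r fischer0l ['X_b * _]mulrC.
  suff -> : (q^`M(e) * 'X_b)@_m = 0 by rewrite conjC0 mulr0 if_same.
  apply: memN_msupp_eq0; rewrite (perm_mem (msuppMX _ _)); apply/mapP => -[n _ mE].
  by move: mb; rewrite mE mnmDE mnm1E eqxx.
have [n mE] : exists n, m = (n + U_(b))%MM.
  by exists (m - U_(b))%MM; rewrite submK // lep1mP.
have -> : ('X_b * q^`M(e))@_m = q@_(n + U_(e)) *+ (n e).+1.
  by rewrite mE ['X_b * _]mulrC addmC mcoeffMX mcoeff_deriv.
rewrite mE addmK -mpolyXD [(U_(e) + n)%MM]addmC -[_ *: _]addr0 fischerDl fischer0l addr0.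
rewrite fischer_monomial !mdegD !mdeg1 !mfactU mnmDE mnm1E eqxx addn1.
case: ifP => _; last by rewrite mulr0.
by rewrite rmorphMn /= !natrM -mulr_natr; ring.
Qed.

Lemma DE a p : D a p = \sum_(b < 27) \sum_(e < 27)
  (if vadd a (tv b) == tv e then (epsz a (tv b))%:~R else 0) *: ('X_e * p^`M(b)).
Proof.
rewrite unlock; apply: eq_bigr => b _; rewrite /Xv mulr_suml scaler_sumr.
rewrite big_mkcond; apply: eq_bigr => e _.
by rewrite eq_sym; case: ifP; rewrite ?scale0r.
Qed.

Lemma epsz_opposite a b e : a \in levi_simple -> b \in tvecs -> e \in tvecs ->
  vadd a b = e -> epsz (vneg a) e = - epsz a b.
Proof.
move=> al bt et; have : all (fun a => all (fun b =>
    (vadd a b \in tvecs) ==> (epsz (vneg a) (vadd a b) == - epsz a b)) tvecs) levi_simple.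
  by vm_compute.
by move/allP/(_ _ al)/allP/(_ _ bt)/implyP => H abe; rewrite -abe in et *; apply/eqP/H.
Qed.

Lemma fischer_suml N I (r : seq I) (f : I -> sym) q :
  fischer N (\sum_(i <- r) f i) q = \sum_(i <- r) fischer N (f i) q.
Proof.
elim: r => [|i r IH]; first by rewrite !big_nil fischer0l.
by rewrite !big_cons -[f i]scale1r fischerDl mul1r IH scale1r.
Qed.

Lemma fischerZl N c p q : fischer N (c *: p) q = c * fischer N p q.
Proof. by rewrite -[c *: p]addr0 fischerDl fischer0l addr0. Qed.

Lemma fischer_sumr N I (r : seq I) (f : I -> sym) q :
  fischer N q (\sum_(i <- r) f i) = \sum_(i <- r) fischer N q (f i).
Proof.
rewrite fischerC fischer_suml rmorph_sum; apply: eq_bigr => i _.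
by rewrite /= -fischerC.
Qed.

Lemma fischerZr N c p q : fischer N q (c *: p) = c^* * fischer N q p.
Proof. by rewrite -[c *: p]addr0 fischerDr fischer0r addr0. Qed.

Lemma fischer_D N a p q : a \in levi_simple ->
  fischer N (D a p) q = - fischer N p (D (vneg a) q).
Proof.
move=> al; rewrite !DE fischer_suml fischer_sumr -sumrN.
under eq_bigr => b _ do rewrite fischer_suml.
rewrite exchange_big; apply: eq_bigr => e _; rewrite fischer_sumr -sumrN.
apply: eq_bigr => b _; rewrite fischerZl fischerZr fischer_elementary -mulNr.
congr (_ * _).
have eq_ab : (vadd a (tv b) == tv e) = (vadd (vneg a) (tv e) == tv b).
  apply/eqP/eqP => [<-|<-]; first by rewrite vaddC vaddKN // size_tvecs ?tv_in.
  by rewrite [vadd (vneg _) _]vaddC vaddNK // size_tvecs ?tv_in.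
rewrite -eq_ab; case: eqP => [abe|_]; last by rewrite conjC0 oppr0.
by rewrite (epsz_opposite al (tv_in b) (tv_in e) abe) rmorph_int rmorphN opprK.
Qed.

(** A lowering operator on the right becomes, up to sign, a raising operator on v and gives 0; w
    itself has another weight. *)
Lemma generated_orthogonal N v w mu nu : has_weight mu v -> has_weight nu w ->
  mu != nu -> (forall a, a \in levi_simple -> D a v = 0) ->
  forall p, generated w p -> fischer N v p = 0.
Proof.
move=> vm wn mn Dv; apply: span_of_min => [|p]; first exact: fischer_subspacer.
elim=> [|_ q /mapP[b bs ->] _ _]; first exact: fischer_weight mn.
by rewrite -[LHS]opprK -fischer_D // Dv // fischer0l oppr0.
Qed.

(** Lowering operators on the left become raising operators on q, which remains in the module
    generated by w. *)
Lemma generated_orthogonal2 N v w mu nu : has_weight mu v -> has_weight nu w ->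
  mu != nu -> (forall a, a \in levi_simple -> D a v = 0) ->
  (forall a, a \in levi_simple -> D a w = 0) ->
  forall p q, generated v p -> generated w q -> fischer N p q = 0.
Proof.
move=> vm wn mn Dv Dw p q vp wq; move: p vp q wq.
apply: (@generated_min _ _ (fun p => forall q, generated w q -> fischer N p q = 0)).
- split=> [q _|c p p' H H' q wq]; first exact: fischer0l.
  by rewrite fischerDl H // H' // mulr0 addr0.
- move=> _ /mapP[b bs ->] p Hp q wq; rewrite fischerC.
  rewrite -[fischer _ _ _]opprK -fischer_D // fischerC Hp ?conjC0 ?oppr0 ?conjC0 //.
  by apply: (generated_pos wn) => //; apply: levi_simple_pos.
- exact: generated_orthogonal mn Dv.
Qed.

Lemma hmon_not_generated i j k i' j' k' :
  generated (hmon F i j k) (hmon F i' j' k') -> [/\ i' = i, j' = j & k' = k].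
Proof.
move=> gh; apply: hweight_inj; apply/eqP/negPn/negP => ww.
case/negP: (hmon_neq0 F i' j' k'); apply/eqP.
apply: (@fischer_def (msize (hmon F i' j' k'))) => //.
have := generated_orthogonal (msize (hmon F i' j' k'))
  (@hmon_weight F i' j' k') (@hmon_weight F i j k) ww.
by apply=> // a al; apply: D_hmon.
Qed.

End Fischer.

(** * The component of degree r *)

Section Decomposition.

Variables (F : numClosedFieldType) (r : nat).
Local Notation sym := (sym F).
Local Notation V := (symr F r).
Local Notation D := (@root_deriv F).
Local Notation hmon := (hmon F).

Lemma generated_vspace i j k :
  exists U : {vspace V}, forall v, v \in U <-> generated (hmon i j k) v.
Proof.
exact/subspace_vspace/(subspace_preim (@mpoly_of_dhomog _ _ _))/generated_subspace.
Qed.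

(** A nonzero submodule contains some [hmon i' j' k']; lying in the module generated by
    [hmon i j k], it has the same exponents, so the submodule is everything. *)
Lemma generated_is_E i j k (U : {vspace V}) : (i + 2 * j + 3 * k = r)%N ->
  (forall v, v \in U <-> generated (hmon i j k) v) ->
  is_E (@symr_act F r) (hweight i j k) (fun v => v \in U).
Proof.
move=> ijk UE; have hr : hmon i j k \is r.-homog by rewrite -ijk; apply: hmon_homog.
pose h : V := DHomog hr.
have Uh : h \in U by apply/UE/generated_self.
have hw := hmon_highest_weight F i j k.
have h0 : h != 0 by rewrite -(inj_eq val_inj) /= hmon_neq0.
split; last first.
  exists h => //; case: hw => _ ht he; split=> // [t t0|a c ap a0]; apply: val_inj => /=.
    exact: ht.
  exact: he.
split; [|by exists h|].
  split; [exact: mem0v | by move=> c u v Uu Uv; rewrite memvD // memvZ |].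
  move=> s Ps v /UE gv; apply/UE.
  by apply: (generated_P7 (@hmon_weight F i j k)) => // a al; apply: D_hmon.
move=> W [W0 Wl Ws] WU.
have [[u [Wu u0]]|Wz] := boolp.pselect (exists u, W u /\ u != 0); last first.
  by left=> u Wu; apply/eqP/negPn/negP => u0; apply: Wz; exists u.
(* W is transported to the full polynomial ring, where the classification applies. *)
right; pose W' (p : sym) := exists2 v, W v & p = v.
have W'm : submodule (@levi_P7 F) (@sym_act F) W'.
  split; first by exists 0.
  - by move=> c _ _ [v Wv ->] [w Ww ->]; exists (c *: v + w); [apply: Wl | rewrite linearP].
  - move=> s /levi_P7_sub Ps _ [v Wv ->]; exists (symr_act s v) => //; exact: Ws.
have [||i' [j' [k' [W'h gW']]]] := levi_submodule_generated W'm (p := u).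
- by exists u.
- by apply: contraNneq u0 => u0; apply/eqP/val_inj.
have [v Wv vE] := W'h.
have gh : generated (hmon i j k) (hmon i' j' k') by rewrite vE; apply/UE/WU.
have [ii jj kk] := hmon_not_generated gh.
subst i' j' k'; move=> x /UE/gW'[y Wy xy].
by rewrite (_ : x = y) //; apply: val_inj.
Qed.

(** The truncation bound is strict, so [r.+1] includes the degree r. *)
Definition orthogonal_to_summands (p : sym) : Prop :=
  p \is r.-homog /\ forall i j k q, (i + 2 * j + 3 * k = r)%N ->
    generated (hmon i j k) q -> fischer r.+1 p q = 0.

Lemma orthogonal_to_summands0 p : orthogonal_to_summands p -> p = 0.
Proof.
move=> po; apply/eqP/negPn/negP => p0.
have [|t t0 q [qr qo]|a al q [qr qo]|w [mu [[wr wo] w0 wm Dw]]] :=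
    @exists_highest_weight F orthogonal_to_summands p _ _ _ po p0.
- split=> [|c u v [ur uo] [vr vo]].
    by split=> [|i j k q _ _]; [exact: rpred0 | exact: fischer0l].
  split=> [|i j k q ijk gq]; first by rewrite rpredD // rpredZ.
  by rewrite fischerDl (uo i j k) // (vo i j k) // mulr0 addr0.
- split.
    by apply/dhomogP => m; rewrite mcoeff_msupp mcoeff_torus // mulf_eq0 negb_or
      => /andP[_]; rewrite -mcoeff_msupp; apply/dhomogP.
  move=> i j k x ijk gx; rewrite fischer_torus // (qo i j k) //.
  by apply: (generated_torus (@hmon_weight F i j k)) => // l; rewrite conjC_eq0.
- split; first exact: dhomog_D.
  move=> i j k x ijk gx; rewrite fischer_D // (qo i j k) ?oppr0 //.
  apply: generated_neg gx; rewrite map_f //; exact: levi_simple_pos.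
have [i [j [k [c [c0 wE _]]]]] := classification (killed_levi_fixed Dw) wm w0.
have wh : w \is (i + 2 * j + 3 * k).-homog by rewrite wE; exact/dhomogZ/hmon_homog.
suff /eqP : w = 0 by rewrite (negPf w0).
apply: (@fischer_def _ r.+1); first by rewrite (msize_homog w0 wr).
apply: (wo i j k); first exact: dhomog_uniq wh wr.
rewrite wE; apply: (subspaceZ (generated_subspace _)); exact: generated_self.
Qed.

(** The kernel is the orthogonal complement of U. The variable vector is the first argument, in
    which the form is linear rather than semilinear. *)
Definition fischer_row (U : {vspace V}) (v : V) : 'rV[F]_(\dim U) :=
  \row_i fischer r.+1 v (vbasis U)`_i.

Lemma fischer_row_is_linear U : linear (fischer_row U).
Proof. by move=> c u v; apply/rowP => i; rewrite !mxE linearP fischerDl. Qed.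

HB.instance Definition _ U :=
  GRing.isLinear.Build F V 'rV[F]_(\dim U) _ (fischer_row U) (fischer_row_is_linear U).

Lemma sym_decomposition :
  exists E : 'I_r.+1 * 'I_r.+1 * 'I_r.+1 -> {vspace V},
    [/\ forall i j k : 'I_r.+1, (i + 2 * j + 3 * k = r)%N ->
          is_E (@symr_act F r)
            (lambda1 *+ i + lambda6 *+ j + (lambda7 *+ 2) *+ k)
            (fun v => v \in E (i, j, k)),
        directv (\sum_(t : 'I_r.+1 * 'I_r.+1 * 'I_r.+1 |
          (t.1.1 + 2 * t.1.2 + 3 * t.2 == r)%N) E t)
      & (\sum_(t : 'I_r.+1 * 'I_r.+1 * 'I_r.+1 |
          (t.1.1 + 2 * t.1.2 + 3 * t.2 == r)%N) E t)%VS = fullv].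
Proof.
have [E EP] := boolp.choice (fun t : 'I_r.+1 * 'I_r.+1 * 'I_r.+1 =>
  generated_vspace t.1.1 t.1.2 t.2).
exists E; split.
- by move=> i j k ijk; apply: generated_is_E ijk (EP (i, j, k)).
- apply/directv_sum_independent => us Eus us0 t tr.
  apply: val_inj; apply: (@fischer_def _ r.+1) => /=.
    have [->|u0] := eqVneq (us t) 0; first by rewrite msize0.
    by rewrite (msize_homog _ (dhomog_is_dhomog (us t))).
  (* Paired with the zero sum, [us t] meets only itself, so its norm is zero. *)
  have : fischer r.+1 (us t) (mpoly_of_dhomog (\sum_(t : 'I_r.+1 * 'I_r.+1 * 'I_r.+1 |
    (t.1.1 + 2 * t.1.2 + 3 * t.2 == r)%N) us t)) = 0 by rewrite us0 fischer0r.
  rewrite linear_sum (bigD1 t) //= -[X in fischer _ _ (X + _)]scale1r fischerDr conjC1 mul1r.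
  rewrite [X in _ + X](_ : _ = 0) ?addr0 //.
  apply: (subspace_sum (fischer_subspacer _ _)) => t' /andP[t'r t't].
  have /EP gt := Eus t tr; have /EP gt' := Eus t' t'r.
  apply: (@generated_orthogonal2 F r.+1 _ _ _ _ (@hmon_weight F _ _ _)
    (@hmon_weight F _ _ _) _ _ _ _ _ gt gt').
  - apply: contraNneq t't => /hweight_inj[/val_inj e1 /val_inj e2 /val_inj e3].
    by apply/eqP; case: t t' e1 e2 e3 {tr t'r gt gt'} => [[a b] c] [[a' b'] c'] /= -> -> ->.
  - by move=> a al; apply: D_hmon.
  - by move=> a al; apply: D_hmon.
set U := (\sum_(t | _) _)%VS.
apply/eqP; rewrite eqEdim subvf /=.
(* The complement of U is zero, so [fischer_row U] is injective and the dimension of the whole space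
   is at most that of U. *)
have ker0 : (fullv :&: lker (linfun (fischer_row U)) = 0)%VS.
  apply/eqP; rewrite -subv0; apply/subvP => v; rewrite memv_cap memvf memv_ker lfunE /= memv0.
  move=> /eqP/rowP vU; apply/eqP/val_inj/orthogonal_to_summands0.
  split=> [|i j k q ijk gq]; first exact: dhomog_is_dhomog.
  have qr : q \is r.-homog by rewrite -ijk; apply: generated_homog gq; apply: hmon_homog.
  have i_r : (i < r.+1)%N by lia.
  have j_r : (j < r.+1)%N by lia.
  have k_r : (k < r.+1)%N by lia.
  pose t := (Ordinal i_r, Ordinal j_r, Ordinal k_r).
  have qU : (DHomog qr : V) \in U.
    apply: (subvP (sumv_sup t _ (subvv _))); first by rewrite /= ijk.
    by apply/EP.
  rewrite -[q]/(mpoly_of_dhomog (DHomog qr)) (coord_vbasis qU) linear_sum.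
  apply: (subspace_sum (fischer_subspacer _ _)) => l _.
  rewrite linearZ /=; apply: (subspaceZ (fischer_subspacer _ _)).
  by move: (vU l); rewrite !mxE.
by rewrite -(limg_dim_eq ker0) (leq_trans (dimvS (subvf _))) // dimvf dim_matrix mul1r.
Qed.

End Decomposition.

Theorem proposition5p25 (R : realType) :
  (forall r : nat,
     exists E : 'I_r.+1 * 'I_r.+1 * 'I_r.+1 -> {vspace symr R[i] r},
       [/\ forall i j k : 'I_r.+1, (i + 2 * j + 3 * k = r)%N ->
             is_E (@symr_act R[i] r)
               (lambda1 *+ i + lambda6 *+ j + (lambda7 *+ 2) *+ k)
               (fun v => v \in E (i, j, k)),
           directv (\sum_(t : 'I_r.+1 * 'I_r.+1 * 'I_r.+1 |
             (t.1.1 + 2 * t.1.2 + 3 * t.2 == r)%N) E t)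
         & (\sum_(t : 'I_r.+1 * 'I_r.+1 * 'I_r.+1 |
             (t.1.1 + 2 * t.1.2 + 3 * t.2 == r)%N) E t)%VS = fullv])
  /\ multiplicity_free (levi_P7 (F := R[i])) (@sym_act R[i])
  /\ (forall lam : weight, fundamental_highest_weight R[i] lam <->
        lam \in [:: lambda1; lambda6; lambda7 *+ 2])
  /\ [/\ highest_weight_degree R[i] lambda1 1,
         highest_weight_degree R[i] lambda6 2
       & highest_weight_degree R[i] (lambda7 *+ 2) 3].
Proof.
split; first exact: sym_decomposition.
split; first exact: sym_multiplicity_free.
split; first exact: fundamental_highest_weightE.
by rewrite lambda1E lambda6E lambda7E; split; apply: hweight_degree.
Qed.
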